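(* Let $r_0\in(0,1)$ and let $\omega:[0,\infty)\to[0,\infty)$ be a non-decreasing continuous function, differentiable on $(0,r_0]$ with $\omega'(r)\ge0$ there, such that $\omega(0)=0$ and $\omega_0:=\omega(r_0)<1$. Let $q>1$, and, with $\lambda_0$, $a(\cdot)$, $\lambda(\cdot)$ as in the context, assume $$\sup\left\{\int_s^{\lambda(ks)}\frac{1}{t\,a^q(t)}\,dt:\ s\ge\lambda_0\right\}<\infty\qquad\text{for all }k\ge1 .$$ Let $f,g\in L^q(\mathbb{R}^n)$ be non-negative functions with $\|f\|_{L^q(\mathbb{R}^n)}\le1$ such that for some constants $l\ge1$, $c_0>0$ and $c_1>0$ the inequality $$⨍_{Q_r(x_0)}f^q\,dx\le c_0\left(⨍_{Q_{lr}(x_0)}f\,dx\right)^{q+\omega(r)}+c_1⨍_{Q_{lr}(x_0)}g^q\,dx$$ holds for all $0<r\le r_0$ and $x_0\in\mathbb{R}^n$ (here $⨍_Q$ denotes the mean value $\frac1{|Q|}\int_Q$). Let $\theta>0$ be determined by $$\frac{4^n(4c_0)^q\,\theta\,e^{\theta M(4c_0)}}{q-1}=\frac12,\qquad\text{where } M(k)=\sup\left\{\int_s^{\lambda(ks)}\frac{1}{t\,a^q(t)}\,dt:\ s\ge \frac{s_0}{k}\right\}\quad (k>0),$$ and let $\varphi=\varphi_{\theta,c_0}:[0,\infty)\to(0,\infty)$ be an increasing $C^1$ function with $$\varphi(s)=\exp\left(\theta(1-\omega_0)\int_{\frac{s_0}{4c_0}}^s\frac{1}{t\,a^q(t)}\,dt\right)\qquad\text{for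 all }s\ge\frac{s_0}{4c_0}.$$ Then $$\int_{\mathbb{R}^n}f^q\varphi(f)\,dx\le4\varphi(\lambda_0)+C\int_{\mathbb{R}^n}g^q\varphi(g)\,dx$$ for a constant $C>0$ independent of $l$, $f$ and $g$.
   Context: $Q_r(x_0)=x_0+[-r/2,r/2]^n$ is the cube with edge $r>0$ and center $x_0\in\mathbb{R}^n$. For the given $q>1$: $\lambda_0=r_0^{-n/q}>1$, $s_0=\lambda_0^{1-\omega_0}$, and $$a(\lambda)=\begin{cases}\lambda^{\omega(\lambda^{-q/n})},&\lambda\ge\lambda_0,\\ \lambda_0^{\omega_0},&0\le\lambda<\lambda_0,\end{cases}\qquad s(\lambda)=\frac{\lambda}{a(\lambda)}\quad(\lambda\ge0).$$ The function $s(\lambda)$ is strictly increasing from $[\lambda_0,\infty)$ onto $[s_0,\infty)$, and $\lambda=\lambda(s)$, $s\ge s_0$, denotes its inverse function from $[s_0,\infty)$ onto $[\lambda_0,\infty)$. Integrals $\int_s^{\lambda(ks)}$ are oriented. Under the assumption of the claim, $M(k)<\infty$ for all $k>0$. *)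

(* Defs.v *)
From HB Require Import structures.
From mathcomp Require Import all_boot all_order all_algebra.
From mathcomp Require Import all_classical all_reals all_analysis.
From mathcomp Require Import ring lra.

Set Implicit Arguments.
Unset Strict Implicit.
Unset Printing Implicit Defensive.

Import Order.TTheory GRing.Theory Num.Theory.
Import numFieldNormedType.Exports.

Local Open Scope classical_set_scope.
Local Open Scope ring_scope.

(* [R^n] with the product sigma-algebra, i.e. the Borel one. *)
Notation Rn R n := (n.-tuple (measurableTypeR R)).

(* The library's sigma-finite structure on [m1 \x m2] is shadowed by the one for
   finite factors, hence an explicit proof. *)
Lemma sigma_finite_prod d1 d2 (T1 : measurableType d1) (T2 : measurableType d2)
    (R : realType) (m1 : {sigma_finite_measure set T1 -> \bar R})
    (m2 : {sigma_finite_measure set T2 -> \bar R}) :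
  sigma_finite setT (m1 \x m2)%E.
Proof.
have /sigma_finiteP[F [TF ndF Foo]] := sigma_finiteT m1.
have /sigma_finiteP[G [TG ndG Goo]] := sigma_finiteT m2.
exists (fun k => F k `*` G k).
  rewrite -setXTT TF TG predeqE => -[x y]; split.
    move=> [/= [i _ Fix] [j _ Gjy]]; exists (maxn i j) => //; split.
    - by move: x Fix; exact/subsetPset/ndF/leq_maxl.
    - by move: y Gjy; exact/subsetPset/ndG/leq_maxr.
  by move=> [i _ []/= ? ?]; split; exists i.
move=> k; have [? ?] := Foo k; have [? ?] := Goo k.
split; first exact: measurableX.
by rewrite product_measure1E// lte_mul_pinfty// ge0_fin_numE.
Qed.

Section tuple_measure.
Context (R : realType) (n : nat).

Definition tuple_cons (x : measurableTypeR R * Rn R n) : Rn R n.+1 :=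
  [tuple of x.1 :: x.2].

Definition tuple_uncons (t : Rn R n.+1) : measurableTypeR R * Rn R n :=
  (thead t, [tuple of behead t]).

Lemma measurable_tuple_cons : measurable_fun setT tuple_cons.
Proof. exact: measurable_cons. Qed.

Lemma measurable_tuple_uncons : measurable_fun setT tuple_uncons.
Proof.
apply: measurable_fun_pair; first exact: measurable_tnth.
exact: measurable_behead.
Qed.

Lemma tuple_consK : cancel tuple_cons tuple_uncons.
Proof. by move=> [x t]; congr pair; apply/val_inj. Qed.

Definition cons_measure (m : {sigma_finite_measure set (Rn R n) -> \bar R})
    : set (Rn R n.+1) -> \bar R :=
  pushforward (lebesgue_measure \x m)%E tuple_cons.

Section cons_measure.
Variable m : {sigma_finite_measure set (Rn R n) -> \bar R}.

Let cons_measurable A : measurable A -> measurable (tuple_cons @^-1` A).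
Proof. by move=> mA; rewrite -[X in measurable X]setTI; exact: measurable_tuple_cons. Qed.

Let cons_measure0 : cons_measure m set0 = 0%E.
Proof. by rewrite /cons_measure /pushforward preimage_set0 measure0. Qed.

Let cons_measure_ge0 A : (0 <= cons_measure m A)%E.
Proof. by rewrite /cons_measure /pushforward; exact: measure_ge0. Qed.

Let cons_measure_sigma_additive : semi_sigma_additive (cons_measure m).
Proof.
move=> F mF tF mUF; rewrite /cons_measure /pushforward preimage_bigcup.
apply: measure_semi_sigma_additive.
- by move=> i; exact: cons_measurable.
- apply/trivIsetP => /= i j _ _ ij; rewrite -preimage_setI.
  by move/trivIsetP : tF => /(_ _ _ _ _ ij) ->//; rewrite preimage_set0.
- by rewrite -preimage_bigcup; exact: cons_measurable.
Qed.

HB.instance Definition _ := isMeasure.Build _ _ _ (cons_measure m)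
  cons_measure0 cons_measure_ge0 cons_measure_sigma_additive.

Let cons_measure_sigma_finite : sigma_finite setT (cons_measure m).
Proof.
have [F TF Foo] := sigma_finite_prod lebesgue_measure m.
exists (fun k => tuple_uncons @^-1` F k).
  by rewrite -preimage_bigcup -TF preimage_setT.
move=> k; have [mFk Fkoo] := Foo k; split.
  by rewrite -[X in measurable X]setTI; exact: measurable_tuple_uncons.
rewrite /cons_measure /pushforward -comp_preimage.
rewrite (_ : _ \o _ = id) ?preimage_id//.
by apply/funext => x; exact: tuple_consK.
Qed.

HB.instance Definition _ := Measure_isSigmaFinite.Build _ _ _
  (cons_measure m) cons_measure_sigma_finite.

End cons_measure.
End tuple_measure.

(* The n-fold product of the one-dimensional Lebesgue measure. *)
Fixpoint lebesgue_Rn (R : realType) (n : nat)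
    : {sigma_finite_measure set (Rn R n) -> \bar R} :=
  if n is k.+1 then cons_measure (lebesgue_Rn R k) else \d_([tuple]).

Definition cube (R : realType) (n : nat) (r : R) (x0 : Rn R n) : set (Rn R n) :=
  [set x | forall i, tnth x0 i - r / 2 <= tnth x i <= tnth x0 i + r / 2].

Lemma measurable_cube (R : realType) (n : nat) (r : R) (x0 : Rn R n) :
  measurable (cube r x0).
Proof.
rewrite (_ : cube r x0 = \bigcap_(i in [set: 'I_n])
    ((fun x : Rn R n => tnth x i) @^-1` `[tnth x0 i - r / 2, tnth x0 i + r / 2])).
  apply: fin_bigcap_measurable => // i _; rewrite -[X in measurable X]setTI.
  by apply: measurable_tnth => //; exact: measurable_itv.
apply/seteqP; split => [x xQ i _|x xQ i] /=; first by rewrite in_itv/= xQ.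
by have := xQ i I; rewrite /= in_itv.
Qed.

Lemma lebesgue_cube (R : realType) (n : nat) (r : R) (x0 : Rn R n) :
  0 <= r -> lebesgue_Rn R n (cube r x0) = (r ^+ n)%:E.
Proof.
move=> r0; elim: n x0 => [|n IHn] x0.
  by rewrite /= diracE mem_set//= => -[].
have beheadE j : tnth [tuple of behead x0] j = tnth x0 (lift ord0 j).
  by rewrite [in RHS](tuple_eta x0) tnthS.
have prE : @tuple_cons R n @^-1` cube r x0 =
    `[thead x0 - r / 2, thead x0 + r / 2] `*` cube r [tuple of behead x0].
  apply/seteqP; split => [[x t] /= xtQ|[x t] /= [xQ tQ] i].
    split=> [|j]; first by rewrite in_itv/=; exact: (xtQ ord0).
    by have := xtQ (lift ord0 j); rewrite /tuple_cons/= tnthS beheadE.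
  have [->|] := eqVneq i ord0; first by move: xQ; rewrite in_itv.
  rewrite eq_sym => /unlift_some[j -> _].
  by rewrite /tuple_cons/= tnthS -beheadE; exact: tQ.
rewrite /= /cons_measure /pushforward prE product_measure1E//; last first.
  exact: measurable_cube.
transitivity (r%:E * (r ^+ n)%:E)%E; last by rewrite -EFinM -exprS.
congr (_ * _)%E; last exact: IHn.
have := lebesgue_measure_itv `[thead x0 - r / 2, thead x0 + r / 2].
rewrite /= lte_fin => ->; case: ifPn => [_|]; first by congr EFin; lra.
by rewrite -leNgt => rle; congr EFin; lra.
Qed.

Definition mean (R : realType) (n : nat) (A : set (Rn R n)) (f : Rn R n -> R) : R :=
  (fine (lebesgue_Rn R n A))^-1 * \int[lebesgue_Rn R n]_(x in A) f x.

(* The oriented integral of [h] from [u] to [v]. *)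
Definition oint (R : realType) (u v : R) (h : R -> R) : R :=
  if u <= v then \int[lebesgue_measure]_(t in `[u, v]) h t
  else - \int[lebesgue_measure]_(t in `[v, u]) h t.

(* [d] is the derivative at [x] of the restriction of [h] to [D]; it is
   one-sided when [x] is an endpoint of the interval [D]. *)
Definition has_derivative_within (R : realType) (D : set R) (h : R -> R)
    (x d : R) : Prop :=
  (h t - h x) / (t - x) @[t --> within D x^'] --> d.

Definition C1_on (R : realType) (D : set R) (h : R -> R) : Prop :=
  exists2 h' : R -> R, {within D, continuous h'} &
    forall x, D x -> has_derivative_within D h x (h' x).

Section data.
Context (R : realType) (n : nat) (q r0 : R) (omega : R -> R).

Definition omega0 : R := omega r0.

Definition lambda0 : R := r0 `^ (- (n%:R / q)).

Definition s0 : R := lambda0 `^ (1 - omega0).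

(* Only the values at [0 <= lambda] matter. *)
Definition afun (lambda : R) : R :=
  if lambda0 <= lambda then lambda `^ (omega (lambda `^ (- (q / n%:R))))
  else lambda0 `^ omega0.

Definition sfun (lambda : R) : R := lambda / afun lambda.

(* The inverse of [sfun] restricted to [[lambda0, +oo[]. *)
Definition lambdafun : R -> R := 'pinv_(cst 0) `[lambda0, +oo[ sfun.

Definition weight (t : R) : R := (t * afun t `^ q)^-1.

Definition supint (k b : R) : \bar R :=
  ereal_sup [set (oint s (lambdafun (k * s)) weight)%:E | s in `[b, +oo[].

Definition Mfun (k : R) : \bar R := supint k (s0 / k).

End data.

(* Main.v *)
(* Stopping-time proof of a Gehring lemma. For [lambda >= lambda0] and a Lebesgue
   point [x] with [f x > lambda], the largest [r] at which the mean of [f^q] over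
   [Q_r(x)] reaches [lambda^q] satisfies [r <= lambda^(-q/n) <= r0]. All larger cubes
   have mean at most [lambda^q], so the factor [l] costs nothing, and the mean of [f]
   over [Q_lr(x)] is at most [lambda], so that the extra exponent [omega r] only costs
   the factor [a(lambda)]. A Vitali covering of [{f > lambda}] by these cubes bounds
   the integral of [f^q] over [{f > lambda}] by integrals of [f] over
   [{f > s(lambda)/(4 c0)}] and of [g^q] over [{g > lambda/sigma}]. Integrating
   against [phi'(lambda) d lambda] over [[lambda0, N]], the choice of [theta] makes the
   term in [f] at most a quarter of the truncated left-hand side; it is absorbed and
   [N] tends to infinity.

   If [4 c0 < 1] the supremum [M(4 c0)] may be negative and truncation spoils the
   absorption, but then Lebesgue differentiation of the hypothesis as [r] tends to [0]
   gives [f^q <= 16 c1 g^q] almost everywhere. *)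
Require Import Defs.
From HB Require Import structures.
From mathcomp Require Import all_boot all_order all_algebra.
From mathcomp Require Import all_classical all_reals all_analysis.
From mathcomp Require Import measurable_realfun.
From mathcomp Require Import ring lra.

Set Implicit Arguments.
Unset Strict Implicit.
Unset Printing Implicit Defensive.

Import Order.TTheory GRing.Theory Num.Theory.
Import numFieldNormedType.Exports.

Local Open Scope classical_set_scope.
Local Open Scope ring_scope.

(** * Coverings by cubes *)

(** The weight [1/(t a^q)] is chosen so that the cost [a(lambda) lambda^(q-1)] of a stopped cube,
    multiplied by it, becomes [s(lambda)^(q-1)/lambda]. Since [s] grows at least like
    [lambda^(1 - omega0)], integrating this up to [lambda(k u)], with [k = 4 c0], loses the factor
    [1/((1 - omega0)(q - 1))] and replaces [phi(u)] by [phi(lambda(k u))]. The factor [1 - omega0]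
    in the exponent of [phi] cancels the first loss, and [M(k)] bounds the second one by
    [exp(theta M(k))].

    Absorption subtracts the unknown from both sides, so the unknown must be finite. For this only
    the argument of [phi] is truncated: the integral of [f^q phi(min(f, N))] is at most [phi(N)].
    Where [f > N] the comparison is then between [phi(N)] and [exp(theta M(k)) phi(N)], hence the
    need for [M(k) >= 0]. The levels also have to lie where [phi] is given by its exponential
    formula, that is above [s0/k]; [k >= 1] ensures both.

    One covering estimate serves twice: for the weak-type bound behind Lebesgue differentiation and
    for the level sets. *)

Section covering.
Context (R : realType) (n : nat).
Implicit Types (x y z : Rn R n) (r s : R).

Local Notation mu := (lebesgue_Rn R n).

Lemma cubeP r x y :
  cube r x y <-> forall i, `|tnth y i - tnth x i| <= r / 2.
Proof.
split=> H i; have := H i; first by rewrite ler_norml => /andP[? ?]; lra.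
by rewrite ler_norml => /andP[? ?]; apply/andP; split; lra.
Qed.

Lemma cube_sub r s x y :
  cube s y x -> cube r x `<=` cube (r + s) y.
Proof.
move=> /cubeP yx z /cubeP xz; apply/cubeP => i.
rewrite (_ : _ - _ = (tnth z i - tnth x i) + (tnth x i - tnth y i)); last by lra.
by rewrite (le_trans (ler_normD _ _))// mulrDl lerD.
Qed.

Lemma cube_le r s x : r <= s -> cube r x `<=` cube s x.
Proof.
move=> rs z /cubeP xz; apply/cubeP => i; apply: le_trans (xz i) _.
by rewrite ler_pM2r// invr_gt0.
Qed.

Lemma cube_sym r x y : cube r x y -> cube r y x.
Proof. by move=> /cubeP H; apply/cubeP => i; rewrite distrC. Qed.

Lemma cube_sub3 r s x y z : r <= s ->
  cube r x z -> cube s y z -> cube r x `<=` cube (3 * s) y.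
Proof.
move=> rs xz yz; rewrite (_ : 3 * s = s + (s + s)); last by lra.
apply: (subset_trans (@cube_le r s x rs)); apply: cube_sub.
exact: (cube_sub yz (cube_sym (cube_le rs xz))).
Qed.

(** Greedy selection: keep a cube of largest edge, drop all cubes meeting it, and recurse on the
    others. A dropped cube meets one that is at least as large, hence lies in its triple. *)
Lemma vitali_cubes (rho : Rn R n -> R) (s : seq (Rn R n)) :
  exists2 t : seq (Rn R n), {subset t <= s} /\ uniq t &
    trivIset [set` t] (fun x => cube (rho x) x) /\
    forall x, x \in s -> 0 <= rho x ->
      exists2 y, y \in t & cube (rho x) x `<=` cube (3 * rho y) y.
Proof.
have [m] := ubnP (size s); elim: m s => // m IHm s sm.
have [->|s0] := eqVneq s [::].
  exists [::]; first by split.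
  by split=> // x y; rewrite /= in_nil.
have [y ys ymax] : exists2 y, y \in s & forall x, x \in s -> rho x <= rho y.
  elim: s s0 {IHm sm} => // a s IH _.
  have [->|s0] := eqVneq s [::].
    by exists a; rewrite ?mem_head// => x; rewrite inE => /eqP ->.
  have [y ys ymax] := IH s0.
  have [ay|/ltW ya] := leP (rho a) (rho y).
    exists y; first by rewrite inE ys orbT.
    by move=> x; rewrite inE => /orP[/eqP->//|]; exact: ymax.
  exists a; first exact: mem_head.
  move=> x; rewrite inE => /orP[/eqP->//|/ymax]; move/le_trans; exact.
pose P x := `[< cube (rho x) x `&` cube (rho y) y = set0 >].
(* The conjunct [x != y] removes [y] even when its own cube is empty, as may happen for negative
   [rho y]; otherwise the list might not shrink. *)
have szP : (size [seq x <- s | P x & x != y] < m)%N.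
  rewrite -ltnS; apply: leq_trans sm; rewrite ltnS size_filter.
  have := @count_predC _ [pred x | P x & x != y] s.
  rewrite /= => <-; rewrite -addn1 leq_add2l -has_count; apply/hasP.
  by exists y => //=; rewrite eqxx andbF.
have [t [ts tu] [tI tc]] := IHm _ szP.
have yt : y \notin t by apply/negP => /ts; rewrite mem_filter eqxx andbF.
exists (y :: t).
  split; last by rewrite /= yt.
  by move=> x; rewrite inE => /orP[/eqP->//|/ts]; rewrite mem_filter => /andP[].
split.
  have tP x : x \in t -> cube (rho x) x `&` cube (rho y) y = set0.
    by move=> /ts; rewrite mem_filter => /andP[/andP[/asboolP]].
  move=> a b /=; rewrite !inE => /orP[/eqP->|at_] /orP[/eqP->|bt]//.
  - by rewrite setIC tP// => /set0P/eqP.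
  - by rewrite tP// => /set0P/eqP.
  - exact: tI.
move=> x xs rx.
have [->|xy] := eqVneq x y.
  exists y; first exact: mem_head.
  by apply: cube_le; move: (le_trans rx (ymax _ xs)); lra.
have [Px|] := boolP (P x).
  have [|z zt xz] := tc x _ rx; first by rewrite mem_filter Px xy.
  by exists z => //; rewrite inE zt orbT.
move=> /asboolP/eqP/set0P[z [xz yz]]; exists y; first exact: mem_head.
exact: cube_sub3 (ymax _ xs) xz yz.
Qed.

(* Cubes with rational data replace a compactness argument: countably many of
   them cover [X], each inside some [cube (rho x) x]. *)
Lemma covering (rho : Rn R n -> R) (X : set (Rn R n)) :
  (forall x, X x -> 0 < rho x) ->
  exists2 C : (set (Rn R n))^nat, (forall j, measurable (C j)) &
    X `<=` \bigcup_j C j /\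
    forall N, exists t : seq (Rn R n),
      [/\ uniq t, (forall x, x \in t -> X x),
          trivIset [set` t] (fun x => cube (rho x) x) &
          \big[setU/set0]_(j < N) C j `<=`
          \bigcup_(x in [set` t]) cube (3 * rho x) x].
Proof.
move=> rho0.
pose c (p : n.-tuple rat * rat) : set (Rn R n) :=
  cube (ratr p.2) [tuple ratr (tnth p.1 i) | i < n].
pose Q p x := X x /\ c p `<=` cube (rho x) x.
pose C j := if unpickle j is Some p
  then if `[< exists x, Q p x >] then c p else set0 else set0.
have CP j : C j = set0 \/ exists2 x, X x & C j `<=` cube (rho x) x.
  rewrite /C; case: (unpickle j) => [p|]; last by left.
  by case: asboolP => [[x [Xx xp]]|_]; [right; exists x|left].
exists C.
  move=> j; rewrite /C; case: (unpickle j) => [p|]//.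
  by case: asboolP => // _; exact: measurable_cube.
split.
  move=> x Xx; have rx := rho0 _ Xx.
  (* A centre within [rho x / 8] of [x] and an edge between [rho x / 4] and [rho x / 2] put [x] into
     the rational cube, which then lies in the cube around [x] of twice its edge. *)
  have rq i : exists u : rat, tnth x i - rho x / 8 < ratr u < tnth x i + rho x / 8.
    have /rat_in_itvoo[u] : tnth x i - rho x / 8 < tnth x i + rho x / 8 by lra.
    by rewrite in_itv /=; exists u.
  have /choice [u uP] := rq.
  have /rat_in_itvoo[d] : rho x / 4 < rho x / 2 by lra.
  rewrite in_itv /= => /andP[d1 d2].
  pose p : n.-tuple rat * rat := ([tuple u i | i < n], d).
  have cE i : tnth [tuple ratr (tnth p.1 i) | i < n] i = ratr (u i) :> R.
    by rewrite !tnth_mktuple.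
  have cx : c p x.
    by move=> i; rewrite cE; have /andP[? ?] := uP i; apply/andP; split => /=; lra.
  have cpx : c p `<=` cube (rho x) x.
    apply: (@subset_trans _ (cube (ratr d + ratr d) x)).
      exact/cube_sub/cube_sym.
    by apply: cube_le; lra.
  exists (pickle p) => //; rewrite /C pickleK.
  by case: asboolP => // -[]; exists x; split.
move=> N.
have [s sP] : exists2 s : seq (Rn R n), (forall x, x \in s -> X x) &
    forall j, (j < N)%N -> C j `<=` set0 \/
      exists2 x, x \in s & C j `<=` cube (rho x) x.
  elim: N => [|N [s sX sP]]; first by exists [::].
  have [CN|[x Xx xC]] := CP N.
    exists s => // j; rewrite ltnS leq_eqVlt => /orP[/eqP->|/sP//].
    by left; rewrite CN.
  exists (x :: s) => [y|j]; first by rewrite inE => /orP[/eqP->//|/sX].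
  rewrite ltnS leq_eqVlt => /orP[/eqP->|/sP[?|[y ys yC]]].
  - by right; exists x => //; exact: mem_head.
  - by left.
  - by right; exists y => //; rewrite inE ys orbT.
move=> sC; have [t [ts tu] [tI tc]] := vitali_cubes rho s.
exists t; split => //; first by move=> x /ts /sP.
rewrite -bigcup_mkord => y [j /= jN Cjy].
have [/(_ _ Cjy)//|[x xs xC]] := sC _ jN.
have [z zt xz] := tc _ xs (ltW (rho0 _ (sP _ xs))).
by exists z => //; apply/xz/xC.
Qed.

End covering.

(** Intersect covers of measure at most [1/(k+1)]. The set [X] may be non-measurable, which suits
    exceptional sets of Lebesgue points. *)
Lemma negligible_small_cover d (T : measurableType d) (R : realType)
    (mu : {measure set T -> \bar R}) (X : set T) :
  (forall e : R, 0 < e -> exists2 U, measurable U /\ X `<=` U & (mu U <= e%:E)%E) ->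
  mu.-negligible X.
Proof.
move=> H; have H' k : exists U, [/\ measurable U, X `<=` U &
    (mu U <= (k.+1%:R^-1)%:E)%E].
  have k0 : 0 < k.+1%:R^-1 :> R by rewrite invr_gt0.
  by have [U [mU XU] Ue] := H _ k0; exists U.
have /choice[U UP] := H'.
exists (\bigcap_k U k); split.
- by apply: bigcapT_measurable => k; have [] := UP k.
- apply/eqP; rewrite eq_le measure_ge0 andbT; apply/lee_addgt0Pr => e e0.
  rewrite add0e; have [k ke] : exists k : nat, k.+1%:R^-1 < e.
    by have [k _ ke] := near_infty_natSinv_lt (PosNum e0); exists k; exact: (ke k (leqnn k)).
  have [mU _ Uk] := UP k.
  apply: le_trans (le_trans Uk _); last by rewrite lee_fin ltW.
  apply: le_measure; rewrite ?inE//.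
    by apply: bigcapT_measurable => j; have [] := UP j.
  exact: bigcap_inf.
- by move=> x Xx k _; have [_ + _] := UP k; exact.
Qed.


Lemma integral_bigsetU_le d (T : measurableType d) (R : realType)
    (mu : {measure set T -> \bar R}) (I : eqType) (s : seq I) (A : I -> set T)
    (F : T -> \bar R) :
  (forall i, measurable (A i)) -> measurable_fun setT F ->
  (forall x, 0 <= F x)%E ->
  (\int[mu]_(x in \big[setU/set0]_(i <- s) A i) F x <=
   \sum_(i <- s) \int[mu]_(x in A i) F x)%E.
Proof.
move=> mA mF F0; elim: s => [|i s IH].
  by rewrite !big_nil integral_set0.
have mU : measurable (\big[setU/set0]_(i <- s) A i) by exact: bigsetU_measurable.
have mFT (B : set T) : measurable_fun B F by exact: measurable_funTS.
rewrite !big_cons -(setDUK (@subsetUl _ (A i) (\big[setU/set0]_(i <- s) A i))).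
rewrite ge0_integral_setU//.
- rewrite leeD2l//; apply: le_trans IH; apply: ge0_subset_integral => //.
    by apply: measurableD => //; exact: measurableU.
  by move=> x [[]].
- by apply: measurableD => //; exact: measurableU.
- by rewrite disj_set2E setDIK.
Qed.

Section lebesgue_points.
Context (R : realType) (n : nat).
Implicit Types (x y z : Rn R n) (r s : R) (h : Rn R n -> R).

Local Notation mu := (lebesgue_Rn R n).

(** A comparison between each cube and its triple becomes a global one: a finite part of the cover
    lies in the triples of disjoint cubes, so the local bounds add up to at most the whole integral
    of [H]. The finite parts increase to [U], and the bound passes to the limit. *)
Lemma covering_integral (rho : Rn R n -> R) (X : set (Rn R n))
    (F H : Rn R n -> \bar R) :
  measurable_fun setT F -> measurable_fun setT H ->
  (forall x, 0 <= F x)%E -> (forall x, 0 <= H x)%E ->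
  (forall x, X x -> 0 < rho x) ->
  (forall x, X x -> \int[mu]_(y in cube (3 * rho x) x) F y <=
                    \int[mu]_(y in cube (rho x) x) H y)%E ->
  exists2 U, measurable U /\ X `<=` U &
    (\int[mu]_(x in U) F x <= \int[mu]_x H x)%E.
Proof.
move=> mF mH F0 H0 rho0 FH; have [C mC [XC CP]] := covering rho0.
exists (\bigcup_j C j); first by split=> //; exact: bigcupT_measurable.
have -> : \bigcup_j C j = \bigcup_N \big[setU/set0]_(j < N) C j.
  apply/seteqP; split => [y [j _ Cy]|y [N _]].
    by exists j.+1 => //; rewrite big_ord_recr; right.
  by rewrite -bigcup_mkord => -[j _ Cy]; exists j.
have mFT (B : set (Rn R n)) : measurable_fun B F by exact: measurable_funTS.
have mHT (B : set (Rn R n)) : measurable_fun B H by exact: measurable_funTS.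
have mUC N : measurable (\big[setU/set0]_(j < N) C j) by exact: bigsetU_measurable.
have ndU : nondecreasing_seq (fun N => \big[setU/set0]_(j < N) C j).
  apply/nondecreasing_seqP => N; rewrite subsetEset big_ord_recr.
  exact: subsetUl.
have cvF := @ge0_nondecreasing_set_cvg_integral _ _ _ _ F mu ndU mUC (fun N => mFT _)
  (fun N x _ => F0 x).
rewrite -(cvg_lim _ cvF)//; apply: lime_le.
  by apply/cvg_ex; eexists; exact: cvF.
apply: nearW => N; have [t [tu tX tI tC]] := CP N.
have mQ r x : measurable (cube r x) by exact: measurable_cube.
apply: (@le_trans _ _
    (\int[mu]_(x in \big[setU/set0]_(x <- t) cube (3 * rho x) x) F x)%E).
  apply: ge0_subset_integral => //; first exact: bigsetU_measurable.
  by move: tC; rewrite bigcup_seq.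
apply: le_trans (integral_bigsetU_le _ _ _ _ _) _ => //.
apply: (@le_trans _ _ (\sum_(x <- t) \int[mu]_(y in cube (rho x) x) H y)%E).
  by rewrite big_seq [leRHS]big_seq; apply: lee_sum => x /tX /FH.
rewrite -(@ge0_integral_bigsetU _ _ _ mu _ (fun x => cube (rho x) x))//.
by apply: ge0_subset_integral => //; exact: bigsetU_measurable.
Qed.

Lemma integral_cube_cst r x (c : R) : 0 <= r ->
  (\int[mu]_(y in cube r x) c%:E = (c * r ^+ n)%:E)%E.
Proof.
move=> r0; rewrite (integral_cst _ (measurable_cube r x)) EFinM.
by rewrite -(lebesgue_cube x r0).
Qed.

(** The Hardy-Littlewood weak-type inequality, localised to [K]: it is [covering_integral] for the
    constant [t] against [3^n h] cut off outside [K]. *)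
Lemma weak_type (t : R) (h : Rn R n -> \bar R) (K X : set (Rn R n)) :
  0 < t -> measurable K -> measurable_fun setT h -> (forall x, 0 <= h x)%E ->
  (forall x, X x -> exists r, [/\ 0 < r, cube r x `<=` K &
      ((t * r ^+ n)%:E <= \int[mu]_(y in cube r x) h y)%E]) ->
  exists2 U, measurable U /\ X `<=` U &
    (t%:E * mu U <= (3 ^+ n)%:E * \int[mu]_(y in K) h y)%E.
Proof.
move=> t0 mK mh h0 XP.
have {}XP x : exists r, X x -> [/\ 0 < r, cube r x `<=` K &
      ((t * r ^+ n)%:E <= \int[mu]_(y in cube r x) h y)%E].
  by have [/XP[r ?]|nX] := pselect (X x); [exists r|exists 0].
have /choice[rho rhoP] := XP.
have n3 : 0 <= 3 ^+ n :> R by exact: exprn_ge0.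
have mhK : measurable_fun setT (h \_ K).
  by apply/(measurable_restrictT h) => //; exact: measurable_funTS.
have hK0 x : (0 <= (h \_ K) x)%E by apply: erestrict_ge0 => y _.
have [||||x /rhoP[]//|x Xx|U UP] := @covering_integral rho X (cst t%:E)
    (fun x => (3 ^+ n)%:E * (h \_ K) x)%E.
- exact: measurable_cst.
- exact: measurable_funeM.
- by move=> x; rewrite lee_fin ltW.
- by move=> x; rewrite mule_ge0.
- have [r0 rK rt] := rhoP _ Xx.
  have mQ := measurable_cube (rho x) x.
  rewrite integral_cube_cst ?mulr_ge0 ?(ltW r0)//.
  rewrite ge0_integralZl//; last exact: measurable_funTS.
  rewrite -integral_mkcondr (setIidl rK) exprMn mulrCA EFinM.
  by rewrite lee_pmul2l// lte_fin exprn_gt0.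
- move=> intU; exists U => //; move: (UP) => [mU _].
  rewrite -(integral_cst mu mU); apply: le_trans intU _.
  by rewrite ge0_integralZl// -integral_mkcond.
Qed.

End lebesgue_points.

(** * Lebesgue points *)

Section lebesgue_differentiation.
Context (R : realType) (n : nat).
Implicit Types (x y z : Rn R n) (r s : R) (h : Rn R n -> R).

Local Notation mu := (lebesgue_Rn R n).

Definition origin : Rn R n := [tuple 0 | i < n].

(** Multiplying by [r ^+ n] instead of taking a mean keeps the integral in the extended reals, so
    that no local integrability is presupposed. *)
Definition lebesgue_point h x := forall e, 0 < e -> exists2 d, 0 < d &
  forall r, 0 < r < d ->
    (\int[mu]_(y in cube r x) (`|h y - h x|)%:E <= (e * r ^+ n)%:E)%E.

Definition ae_lebesgue_point h := mu.-negligible [set x | ~ lebesgue_point h x].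

Lemma measurable_EFin_dist h (c : R) : measurable_fun setT h ->
  measurable_fun setT (fun y => (`|h y - c|)%:E).
Proof.
move=> mh; apply/measurable_EFinP; apply: measurableT_comp => //.
exact: measurable_funB.
Qed.

Lemma lebesgue_point_locally_cst h x (d : R) : 0 < d ->
  (forall y, cube d x y -> h y = h x) -> lebesgue_point h x.
Proof.
move=> d0 hx e e0; exists d => // r /andP[r0 rd].
rewrite integral0_eq; first by rewrite lee_fin mulr_ge0 ?exprn_ge0 ?(ltW _).
by move=> y /(cube_le (ltW rd)) /hx ->; rewrite subrr normr0.
Qed.

(** Only the oscillation matters, so this one criterion yields the closure under sums, multiples,
    complements and unions. *)
Lemma ae_lebesgue_point_dominated (f g h : Rn R n -> R) (c : R) :
  measurable_fun setT f -> measurable_fun setT g -> measurable_fun setT h ->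
  0 < c ->
  (forall x y, `|h y - h x| <= c * (`|f y - f x| + `|g y - g x|)) ->
  ae_lebesgue_point f -> ae_lebesgue_point g -> ae_lebesgue_point h.
Proof.
move=> mf mg mh c0 hfg lf lg; apply: negligibleS (negligibleU lf lg) => x /=.
apply: contra_notP => /not_orP[/contrapT fx /contrapT gx] e e0.
have e2 : 0 < e / (2 * c) by rewrite divr_gt0// mulr_gt0.
have [d1 d10 fd] := fx _ e2; have [d2 d20 gd] := gx _ e2.
exists (Num.min d1 d2); first by rewrite lt_min d10.
move=> r /andP[r0]; rewrite lt_min => /andP[rd1 rd2].
have mQ := measurable_cube r x.
have [mfx mgx mhx] : [/\ measurable_fun setT (fun y => (`|f y - f x|)%:E),
  measurable_fun setT (fun y => (`|g y - g x|)%:E) &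
  measurable_fun setT (fun y => (`|h y - h x|)%:E)].
  by split; exact: measurable_EFin_dist.
apply: (@le_trans _ _ (\int[mu]_(y in cube r x)
    (c%:E * ((`|f y - f x|)%:E + (`|g y - g x|)%:E)))%E).
  apply: ge0_le_integral => //.
  - exact: measurable_funTS.
  - apply: measurable_funTS; apply: measurable_funeM.
    exact: emeasurable_funD.
  - by move=> y _; rewrite -EFinD -EFinM lee_fin.
rewrite ge0_integralZl//; last 3 first.
- by apply: measurable_funTS; exact: emeasurable_funD.
- by move=> y _; rewrite adde_ge0.
- by rewrite lee_fin ltW.
rewrite ge0_integralD//; [|exact: measurable_funTS|exact: measurable_funTS].
have -> : (e * r ^+ n)%:E =
    (c%:E * ((e / (2 * c) * r ^+ n)%:E + (e / (2 * c) * r ^+ n)%:E))%E.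
  by rewrite -EFinD -EFinM; congr EFin; field; rewrite gt_eqF.
by rewrite lee_pmul2l// leeD// ?fd ?gd ?r0.
Qed.

(** Closure under local [L^1] limits. In [|h - h x| <= |h - h'| + |h' - h' x| + |h' x - h x|] each
    term has mean at most [eps / 3] over small cubes, outside three small sets: [V] from the
    weak-type bound, the null set [N] of the approximant, and [W] from Chebyshev's inequality. *)
Lemma ae_lebesgue_point_approx h : measurable_fun setT h ->
  (forall (m : nat) (e : R), 0 < e -> exists2 h' : Rn R n -> R,
     measurable_fun setT h' /\ ae_lebesgue_point h' &
     (\int[mu]_(y in cube m%:R origin) (`|h y - h' y|)%:E <= e%:E)%E) ->
  ae_lebesgue_point h.
Proof.
move=> mh happ.
(* Countably many pieces of the exceptional set, indexed by location and by tolerance [1/(k+1)]. *)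
pose B (m k : nat) := [set x | cube m%:R origin x /\
  ~ exists2 d, 0 < d & forall r, 0 < r < d ->
    (\int[mu]_(y in cube r x) (`|h y - h x|)%:E <= (k.+1%:R^-1 * r ^+ n)%:E)%E].
suff nB m k : mu.-negligible (B m k).
  apply: (@negligibleS _ _ _ _ (\bigcup_m \bigcup_k B m k)); last first.
    by apply: negligible_bigcup => m; apply: negligible_bigcup => k.
  move=> x /=; rewrite /lebesgue_point => /existsNP[e] /not_implyP[e0 ex].
  pose b := \sum_(i < n) `|tnth x i|.
  exists (Num.truncn (2 * b)).+1 => //.
  have [k _ ke] := near_infty_natSinv_lt (PosNum e0).
  exists k => //; split.
    apply/cubeP => i; rewrite tnth_mktuple subr0.
    apply: (@le_trans _ _ b); first by rewrite /b (bigD1 i)//= lerDl sumr_ge0.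
    have b0 : 0 <= 2 * b by rewrite mulr_ge0// sumr_ge0.
    by have := truncnS_gt (2 * b); lra.
  move=> [d d0 xd]; apply: ex; exists d => // r rd.
  apply: le_trans (xd _ rd) _; rewrite lee_fin ler_wpM2r//.
    by rewrite exprn_ge0// ltW//; case/andP: rd.
  by have := ke k (leqnn k) => /= /ltW.
(* Two units of margin: a cube of edge below 2 centred in [cube m%:R origin] stays in [K]. *)
set K := cube (m.+2)%:R origin.
have mK : measurable K by exact: measurable_cube.
pose eps : R := k.+1%:R^-1.
have eps0 : 0 < eps by rewrite invr_gt0.
apply: negligible_small_cover => e e0.
have n3 : 0 < 3 ^+ n :> R by exact: exprn_gt0.
(* The weak-type bound multiplies by [3^n] and divides by [eps / 3], which leaves [e / 2] for [V];
   for [W] the factor [3^n] is not incurred. *)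
pose e' := (eps / 3) * e / (2 * 3 ^+ n).
have e'0 : 0 < e' by rewrite divr_gt0// ?mulr_gt0// divr_gt0.
have [h' [mh' [N [mN N0 h'N]]] hh'] := happ m.+2 _ e'0.
have mhh' : measurable_fun setT (fun y => (`|h y - h' y|)%:E).
  apply/measurable_EFinP; apply: measurableT_comp => //.
  exact: measurable_funB.
pose X := [set x | exists r, [/\ 0 < r, cube r x `<=` K &
  ((eps / 3 * r ^+ n)%:E <= \int[mu]_(y in cube r x) (`|h y - h' y|)%:E)%E]].
have [||||x|V [mV XV] muV] := @weak_type R n (eps / 3)
  (fun y => (`|h y - h' y|)%:E) K X => //.
  by rewrite divr_gt0.
pose W := K `&` [set x | (eps / 3)%:E <= `|(h x - h' x)%:E|]%E.
have mW : measurable W.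
  apply: emeasurable_fun_c_infty => //; apply: measurableT_comp => //.
  apply: measurable_funTS; apply/measurable_EFinP.
  exact: measurable_funB.
have muW : ((eps / 3)%:E * mu W <= e'%:E)%E.
  apply: le_trans hh'.
  apply: (@le_integral_abse _ _ _ mu K mK (fun x => (h x - h' x)%:E)).
    by apply: measurable_funTS; apply/measurable_EFinP; exact: measurable_funB.
  by rewrite divr_gt0.
have e3 : 0 < eps / 3 by rewrite divr_gt0.
have muV' : (mu V <= (e / 2)%:E)%E.
  rewrite -(@lee_pmul2l _ (eps / 3)%:E)//; apply: le_trans muV _.
  apply: (@le_trans _ _ ((3 ^+ n)%:E * e'%:E)%E); first by rewrite lee_pmul2l.
  rewrite -!EFinM lee_fin /e' le_eqVlt; apply/orP; left; apply/eqP.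
  by field; rewrite gt_eqF.
have muW' : (mu W <= (e / 2)%:E)%E.
  rewrite -(@lee_pmul2l _ (eps / 3)%:E)//; apply: le_trans muW _.
  rewrite -EFinM lee_fin /e'.
  rewrite (_ : eps / 3 * (e / 2) = eps / 3 * e / 2); last by field.
  rewrite ler_pM2l ?mulr_gt0// lef_pV2 ?posrE ?mulr_gt0//.
  by rewrite ler_peMr// exprn_ege1// ler1n.
exists (N `|` (V `|` W)).
  split; first by apply: measurableU => //; exact: measurableU.
  move=> x [xm xb].
  have [|Nx] := pselect (N x); [by left|right].
  have [|Vx] := pselect (V x); [by left|right].
  have Kx : K x by apply: cube_le xm; rewrite ler_nat leqW.
  split=> //=; rewrite leNgt; apply/negP => hx.
  apply: xb.
  have /contrapT h'x : ~ ~ lebesgue_point h' x by move=> /h'N.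
  have [d d0 h'd] := h'x _ e3.
  exists (Num.min d 2); first by rewrite lt_min d0 ltr0n.
  move=> r /andP[r0]; rewrite lt_min => /andP[rd r1].
  have mQ := measurable_cube r x.
  have rK : cube r x `<=` K.
    apply: (@subset_trans _ (cube (2 + m%:R) origin)).
      by apply: (subset_trans (cube_le (ltW r1))); exact: cube_sub.
    by apply: cube_le; rewrite -natrD.
  have ghh' : (\int[mu]_(y in cube r x) (`|h y - h' y|)%:E <= (eps / 3 * r ^+ n)%:E)%E.
    rewrite leNgt; apply/negP => /ltW hr; apply: Vx; apply: XV; exists r.
    by split.
  have mh'x : measurable_fun setT (fun y => (`|h' y - h' x|)%:E).
    exact: measurable_EFin_dist.
  apply: (@le_trans _ _ (\int[mu]_(y in cube r x) (`|h y - h' y|%:E +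
      (`|h' y - h' x|%:E + (eps / 3)%:E)))%E).
    apply: ge0_le_integral => //.
    - by apply: measurable_funTS; exact: measurable_EFin_dist.
    - apply: measurable_funTS; apply: emeasurable_funD => //.
      exact: emeasurable_funD.
    - move=> y _; rewrite -!EFinD lee_fin.
      move: hx; rewrite lte_fin => /ltW hx.
      rewrite (_ : h y - h x = (h y - h' y) + ((h' y - h' x) - (h x - h' x))); last by lra.
      rewrite (le_trans (ler_normD _ _))// lerD2l.
      by rewrite (le_trans (ler_normB _ _))// lerD2l.
  rewrite ge0_integralD//; last 3 first.
  - exact: measurable_funTS.
  - by move=> y _; rewrite -EFinD lee_fin addr_ge0// ltW.
  - by apply: measurable_funTS; exact: emeasurable_funD.
  rewrite ge0_integralD//; last 2 first.
  - exact: measurable_funTS.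
  - by move=> y _; rewrite lee_fin ltW.
  rewrite (integral_cube_cst _ _ (ltW r0)).
  rewrite -/eps.
  rewrite (_ : eps * r ^+ n =
      eps / 3 * r ^+ n + (eps / 3 * r ^+ n + eps / 3 * r ^+ n)); last by field.
  by rewrite !EFinD leeD// leeD// h'd// r0.
apply: (@le_trans _ _ (mu N + (mu V + mu W))%E).
  rewrite (le_trans (measureU2 _ _ _))//; first exact: measurableU.
  by rewrite leeD2l// measureU2.
rewrite N0 add0e (_ : e = e / 2 + e / 2) ?EFinD ?leeD//; lra.
Qed.

End lebesgue_differentiation.

(** * The Lebesgue differentiation theorem for cubes *)

Lemma ltr_near (R : realDomainType) (a u v : R) :
  `|v - u| < `|u - a| -> (a < v) = (a < u).
Proof.
by case: (ger0P (u - a)) => ua; rewrite ltr_norml => /andP[? ?];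
  apply/idP/idP => ?; lra.
Qed.

Lemma lebesgue_hyperplane (R : realType) (n : nat) (i : 'I_n) (a : R) :
  lebesgue_Rn R n [set x | tnth x i = a] = 0%E.
Proof.
have mH (k : nat) (j : 'I_k) (A : set R) : measurable A ->
    measurable [set x : Rn R k | A (tnth x j)].
  by move=> mA; rewrite -[X in measurable X]setTI; exact: measurable_tnth.
elim: n i => [[]//|n IHn] i; rewrite /= /cons_measure /pushforward.
have [->|] := eqVneq i ord0.
  have -> : @tuple_cons R n @^-1` [set x | tnth x ord0 = a] = [set a] `*` setT.
    by apply/seteqP; split => [[x t] xa|[x t] [xa _]]; first split => //; exact: xa.
  by rewrite product_measure1E ?mul0e//= lebesgue_measure_set1 mul0e.
rewrite eq_sym => /unlift_some[j -> _].
have -> : @tuple_cons R n @^-1` [set x | tnth x (lift ord0 j) = a] =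
    setT `*` [set t | tnth t j = a].
  by apply/seteqP; split => [[x t]|[x t]]; rewrite /= /tuple_cons/= tnthS//= => -[].
rewrite product_measure1E//; last exact: (@mH _ j [set a]).
by rewrite (IHn j) mule0.
Qed.

Section lebesgue_differentiation_theorem.
Context (R : realType) (n : nat).
Implicit Types (x y z : Rn R n) (r s : R) (h : Rn R n -> R).

Local Notation mu := (lebesgue_Rn R n).

Lemma ae_lebesgue_point_cst (c : R) :
  ae_lebesgue_point (fun _ : Rn R n => c).
Proof.
apply: negligibleS (negligible_set0 _) => x /=; apply.
exact: (@lebesgue_point_locally_cst _ _ _ _ 1).
Qed.

Lemma ae_lebesgue_pointD (f g : Rn R n -> R) :
  measurable_fun setT f -> measurable_fun setT g ->
  ae_lebesgue_point f -> ae_lebesgue_point g ->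
  ae_lebesgue_point (fun x => f x + g x).
Proof.
move=> mf mg; apply: (@ae_lebesgue_point_dominated _ _ _ _ _ 1) => //.
  exact: measurable_funD.
by move=> x y; rewrite mul1r opprD addrACA ler_normD.
Qed.

Lemma ae_lebesgue_pointZ (k : R) (f : Rn R n -> R) :
  measurable_fun setT f -> ae_lebesgue_point f ->
  ae_lebesgue_point (fun x => k * f x).
Proof.
move=> mf lf.
apply: (@ae_lebesgue_point_dominated _ _ f (fun=> 0) _ (`|k| + 1)) => //.
- exact: measurable_funM.
- move=> x y; rewrite -mulrBr normrM subrr normr0 addr0 ler_wpM2r//.
  by rewrite lerDl.
- exact: ae_lebesgue_point_cst.
Qed.

(** Good sets: they form a sigma-algebra containing the strips [a < x_i <= b], hence contain every
    measurable set. This takes the place of approximation by continuous functions. *)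
Definition lebesgue_set (B : set (Rn R n)) :=
  measurable B /\ ae_lebesgue_point (\1_B : Rn R n -> R).

Lemma lebesgue_setC B : lebesgue_set B -> lebesgue_set (~` B).
Proof.
move=> [mB lB]; split; first exact: measurableC.
apply: (ae_lebesgue_point_dominated _ _ _ (@ltr01 R) _ lB lB) => //.
- by apply: measurable_indic; exact: measurableC.
- move=> x y; rewrite mul1r !indicE !in_setC.
  by case: (x \in B); case: (y \in B); 
    rewrite /= ?subrr ?subr0 ?sub0r ?normrN ?normr0 ?normr1 ?addr0// lerDl.
Qed.

Lemma lebesgue_setU A B : lebesgue_set A -> lebesgue_set B -> lebesgue_set (A `|` B).
Proof.
move=> [mA lA] [mB lB]; split; first exact: measurableU.
apply: (ae_lebesgue_point_dominated _ _ _ (@ltr01 R) _ lA lB) => //.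
- by apply: measurable_indic; exact: measurableU.
- move=> x y; rewrite mul1r !indicE !in_setU.
  by case: (x \in A); case: (y \in A); case: (x \in B); case: (y \in B);
    rewrite /= ?subrr ?subr0 ?sub0r ?normrN ?normr0 ?normr1 ?addr0 ?add0r// lerDl.
Qed.

Lemma lebesgue_set0 : lebesgue_set set0.
Proof. by split => //; rewrite indic0; exact: ae_lebesgue_point_cst. Qed.

(** On a bounded cube, which has finite measure, the indicators of the finite unions converge in
    [L^1] to that of the countable union, so [ae_lebesgue_point_approx] applies. *)
Lemma lebesgue_set_bigcup (B : (set (Rn R n))^nat) :
  (forall j, lebesgue_set (B j)) -> lebesgue_set (\bigcup_j B j).
Proof.
move=> lB; have mB j : measurable (B j) by have [] := lB j.
have mU : measurable (\bigcup_j B j) by exact: bigcupT_measurable.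
have lU N : lebesgue_set (\big[setU/set0]_(j < N) B j).
  elim: N => [|N IH]; first by rewrite big_ord0; exact: lebesgue_set0.
  by rewrite big_ord_recr; exact: lebesgue_setU.
split=> //; apply: ae_lebesgue_point_approx => [|m e e0].
  exact: measurable_indic.
pose K := cube m%:R (@origin R n).
have mK : measurable K by exact: measurable_cube.
pose D N := K `&` (\bigcup_j B j `\` \big[setU/set0]_(j < N) B j).
have mD N : measurable (D N).
  apply: measurableI => //; apply: measurableD => //.
  by have [] := lU N.
have D0 : \bigcap_N D N = set0.
  rewrite -subset0 => x Dx; have [_ [[j _ Bjx] _]] := Dx 0%N I.
  have [_ [_]] := Dx j.+1 I; apply.
  by rewrite big_ord_recr; right.
have cvD : mu (D N) @[N --> \oo] --> (0 : \bar R)%E.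
  rewrite -(@measure0 _ _ _ mu) -D0.
  apply: nonincreasing_cvg_mu => //.
  - apply: (@le_lt_trans _ _ (mu K)).
      by apply: le_measure; rewrite ?inE//; exact: subIsetl.
    by rewrite lebesgue_cube// ltry.
  - by rewrite D0.
  - apply/nonincreasing_seqP => N; rewrite subsetEset; apply: setIS; apply: setDS.
    by rewrite big_ord_recr; exact: subsetUl.
have [N De] : exists N, (mu (D N) <= e%:E)%E.
  move/fine_cvgP: cvD => [[N1 _ DN1]] /cvgrPdist_lt /(_ _ e0)[N2 _ DN2].
  exists (maxn N1 N2).
  have := DN1 _ (leq_maxl N1 N2); have := DN2 _ (leq_maxr N1 N2) => /=.
  rewrite sub0r normrN => /ltW /(le_trans (ler_norm _)) + DN.
  by rewrite -lee_fin fineK.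
exists (\1_(\big[setU/set0]_(j < N) B j)).
  by have [mUN lUN] := lU N; split => //; exact: measurable_indic.
apply: le_trans De.
rewrite (_ : mu (D N) = (\int[mu]_(y in K) (\1_(D N) y)%:E)%E); last first.
  by rewrite integral_indic//; congr (mu _); rewrite /D setIAC setIid.
apply: ge0_le_integral => //.
- apply: measurable_funTS; apply/measurable_EFinP; apply: measurableT_comp => //.
  have [mUN _] := lU N.
  by apply: measurable_funB; exact: measurable_indic.
- by apply: measurable_funTS; apply/measurable_EFinP; exact: measurable_indic.
- move=> x Kx; rewrite lee_fin !indicE in_setI in_setD (mem_set Kx) andTb.
  have [xN|xN] := boolP (x \in \big[setU/set0]_(j < N) B j).
    have -> : x \in \bigcup_j B j.
      move/set_mem : xN; rewrite -bigcup_mkord => -[j _ Bj].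
      by apply/mem_set; exists j.
    by rewrite subrr normr0.
  by rewrite subr0 ger0_norm// andbT.
Qed.

Lemma sigma_algebra_lebesgue_set : sigma_algebra setT lebesgue_set.
Proof.
split; [exact: lebesgue_set0| |exact: lebesgue_set_bigcup].
by move=> A lA; rewrite setTD; exact: lebesgue_setC.
Qed.

(** Off the two bounding hyperplanes, which are null, the indicator is locally constant. *)
Lemma lebesgue_set_strip (i : 'I_n) (a b : R) :
  lebesgue_set [set x | `]a, b]%classic (tnth x i)].
Proof.
split.
  by rewrite -[X in measurable X]setTI; exact: measurable_tnth.
apply: (@negligibleS _ _ _ _
    ([set x : Rn R n | tnth x i = a] `|` [set x : Rn R n | tnth x i = b])).
  move=> x /=; apply: contra_notP => /not_orP[/eqP xa /eqP xb].
  pose d := Num.min `|tnth x i - a| `|tnth x i - b|.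
  have d0 : 0 < d by rewrite lt_min !normr_gt0 !subr_eq0 xa.
  apply: (@lebesgue_point_locally_cst _ _ _ _ d) => // y /cubeP /(_ i) yx.
  have [ya yb] : `|tnth y i - tnth x i| < `|tnth x i - a| /\
      `|tnth y i - tnth x i| < `|tnth x i - b|.
    have : d / 2 < d by lra.
    by rewrite {2}/d lt_min => /andP[? ?]; split; apply: le_lt_trans yx _.
  rewrite !indicE; congr (nat_of_bool _)%:R.
  apply/idP/idP => /set_mem/=; rewrite in_itv/= => vab; apply/mem_set => /=;
    rewrite in_itv/=; move: vab; rewrite ![_ <= b]leNgt.
    by rewrite (ltr_near ya) (ltr_near yb).
  by rewrite (ltr_near ya) (ltr_near yb).
have mH c : measurable [set x : Rn R n | tnth x i = c].
  rewrite -[X in measurable X]setTI.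
  exact: (measurable_tnth i measurableT (measurable_set1 c)).
by apply: negligibleU; apply/negligibleP => //; exact: lebesgue_hyperplane.
Qed.

Lemma measurable_lebesgue_set B : measurable B -> lebesgue_set B.
Proof.
move: B; apply: smallest_sub; first exact: sigma_algebra_lebesgue_set.
(* Two generation steps: the product sigma-algebra comes from the coordinate preimages, and the
   Borel sets of the line come from the half-open intervals. *)
have sub (i : 'I_n) (A : set (measurableTypeR R)) : measurable A ->
    lebesgue_set [set x | A (tnth x i)].
  move: A; apply: smallest_sub.
    split=> [|A lA|A lA]; first exact: lebesgue_set0.
      by rewrite setTD; exact: lebesgue_setC lA.
    have -> : [set x : Rn R n | (\bigcup_k A k) (tnth x i)] =
        \bigcup_k [set x | A k (tnth x i)] by [].
    exact: lebesgue_set_bigcup.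
  by move=> A [[a b] _ <-]; exact: lebesgue_set_strip.
move=> B; rewrite -bigcup_seq => -[i _ [A mA <-]].
by rewrite setTI; exact: sub.
Qed.

Import HBSimple.

(** Simple functions are finite combinations of indicators of good sets and approximate [h] in
    [L^1]. *)
Lemma lebesgue_differentiation_Rn h :
  mu.-integrable setT (EFin \o h) -> ae_lebesgue_point h.
Proof.
move=> ih; have mh : measurable_fun setT h.
  by apply/measurable_EFinP; exact: measurable_int ih.
apply: ae_lebesgue_point_approx => // m e e0.
have [g_ [ig _ gh]] := approximation_sfun_integrable measurableT ih.
have [N hN] : exists N, (\int[mu]_z `|(EFin \o h) z - (g_ N z)%:E| <= e%:E)%E.
  move/fine_cvgP: gh => [[N1 _ DN1]] /cvgrPdist_lt /(_ _ e0)[N2 _ DN2].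
  exists (maxn N1 N2).
  have := DN1 _ (leq_maxl N1 N2); have := DN2 _ (leq_maxr N1 N2) => /=.
  rewrite sub0r normrN => /ltW /(le_trans (ler_norm _)) + DN.
  by rewrite -lee_fin fineK.
exists (g_ N).
  split; first exact: measurable_funPT.
  have [s ->] : exists s : seq R, (g_ N : Rn R n -> R) =
      (fun x => \sum_(c <- s) c * \1_(g_ N @^-1` [set c]) x).
    by eexists; apply/funext => x; rewrite [LHS]fimfunE fsbig_finite.
  have mI c : measurable_fun setT (\1_(g_ N @^-1` [set c]) : Rn R n -> R).
    exact: measurable_indic.
  suff [] : measurable_fun setT (fun x => \sum_(c <- s) c * \1_(g_ N @^-1` [set c]) x) /\
    ae_lebesgue_point (fun x => \sum_(c <- s) c * \1_(g_ N @^-1` [set c]) x) by [].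
  elim: s => [|c s [ms ls]].
    under eq_fun do rewrite big_nil.
    split; [exact: measurable_cst|exact: ae_lebesgue_point_cst].
  under eq_fun do rewrite big_cons.
  have mc : measurable_fun setT (fun x => c * \1_(g_ N @^-1` [set c]) x).
    exact: measurable_funM.
  split; first exact: measurable_funD.
  apply: ae_lebesgue_pointD => //; apply: ae_lebesgue_pointZ => //.
  by have [] : lebesgue_set (g_ N @^-1` [set c]) by exact: measurable_lebesgue_set.
apply: le_trans hN; rewrite /=.
have mhg : measurable_fun setT (fun z => (`|h z - g_ N z|)%:E).
  apply/measurable_EFinP; apply: measurableT_comp => //.
  by apply: measurable_funB => //; exact: measurable_funPT.
apply: (@le_trans _ _ (\int[mu]_z (`|h z - g_ N z|)%:E)%E).
  by apply: ge0_subset_integral => //; exact: measurable_cube.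
by apply: ge0_le_integral.
Qed.

End lebesgue_differentiation_theorem.

(** * Level sets *)

Lemma root_exprnK (R : realType) (n : nat) (c : R) :
  (0 < n)%N -> 0 <= c -> (c `^ n%:R^-1) ^+ n = c.
Proof.
move=> n0 c0.
by rewrite -powR_mulrn ?powR_ge0// -powRrM mulVf ?powRr1// pnatr_eq0 -lt0n.
Qed.

Lemma exprn_le_root (R : realType) (n : nat) (r c : R) :
  (0 < n)%N -> 0 <= r -> 0 <= c -> (r ^+ n <= c) = (r <= c `^ n%:R^-1).
Proof.
by move=> n0 r0 c0; rewrite -{1}(root_exprnK n0 c0) ler_pXn2r// nnegrE powR_ge0.
Qed.

Lemma root_le_exprn (R : realType) (n : nat) (r c : R) :
  (0 < n)%N -> 0 <= r -> 0 <= c -> (c <= r ^+ n) = (c `^ n%:R^-1 <= r).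
Proof.
by move=> n0 r0 c0; rewrite -{1}(root_exprnK n0 c0) ler_pXn2r// nnegrE powR_ge0.
Qed.

(** Young's inequality for [u / lambda] and 1, multiplied by [lambda]. Equality at [u = lambda]
    makes the bound of [mean_fun_le] exactly [lambda]. *)
Lemma le_mixed_powR (R : realType) (q lambda u : R) : 1 < q -> 0 < lambda -> 0 <= u ->
  u <= lambda * lambda `^ (- q) / q * u `^ q + (1 - q^-1) * lambda.
Proof.
move=> q1 l0 u0; have q0 : 0 < q by lra.
have q1' : 0 < 1 - q^-1 by rewrite subr_gt0 invf_lt1.
have := @conjugate_powR R (u / lambda) 1 q (1 - q^-1)^-1 _ ler01 q0 _ _.
rewrite invr_gt0 => /(_ (divr_ge0 u0 (ltW l0)) q1').
rewrite invrK addrC subrK => /(_ erefl).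
rewrite mulr1 powR1 mul1r powRM ?invr_ge0 ?(ltW l0)// -(powR_inv1 (ltW l0)) -powRrM mulN1r.
rewrite powR_inv1 ?(ltW l0)// ler_pdivrMr// => /le_trans; apply.
by rewrite le_eqVlt; apply/orP; left; apply/eqP; field; rewrite gt_eqF.
Qed.

Section stopping.
Context (R : realType) (n : nat).
Implicit Types (x y z : Rn R n) (r s : R) (h : Rn R n -> R).

Local Notation mu := (lebesgue_Rn R n).

Lemma mean_cube h r x : 0 < r -> mu.-integrable (cube r x) (EFin \o h) ->
  (\int[mu]_(y in cube r x) (h y)%:E = (mean (cube r x) h * r ^+ n)%:E)%E.
Proof.
move=> r0 ih; rewrite /mean lebesgue_cube ?(ltW r0)//= /Rintegral.
have r0n : r ^+ n != 0 by rewrite expf_neq0// gt_eqF.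
rewrite mulrAC mulVf// mul1r fineK//.
exact: (integrable_fin_num (measurable_cube r x) ih).
Qed.

Lemma integrable_cubeS h r x : mu.-integrable setT (EFin \o h) ->
  mu.-integrable (cube r x) (EFin \o h).
Proof. by apply: integrableS => //; exact: measurable_cube. Qed.

(* [r] is the supremum of the radii reaching [T]; that the integral over a cube is
   monotone in the radius is enough, no continuity is needed. *)
Lemma stopping_radius (h : Rn R n -> R) x (T : R) :
  (0 < n)%N -> (forall y, 0 <= h y) -> mu.-integrable setT (EFin \o h) ->
  (\int[mu]_y (h y)%:E <= 1)%E ->
  lebesgue_point h x -> 0 < T -> T < h x ->
  exists r, [/\ 0 < r, T * r ^+ n <= 1,
    ((T * r ^+ n)%:E <= \int[mu]_(y in cube r x) (h y)%:E)%E &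
    forall s, r <= s ->
      (\int[mu]_(y in cube s x) (h y)%:E <= (T * s ^+ n)%:E)%E].
Proof.
move=> n0 h0 ih ih1 lx T0 Tx.
have mh : measurable_fun setT h by apply/measurable_EFinP; exact: measurable_int ih.
pose J r := fine (\int[mu]_(y in cube r x) (h y)%:E)%E.
have JE r : (\int[mu]_(y in cube r x) (h y)%:E = (J r)%:E)%E.
  rewrite fineK//.
  exact: (integrable_fin_num (measurable_cube r x) (integrable_cubeS _ _ ih)).
have J_nd r s : r <= s -> J r <= J s.
  move=> rs; rewrite -lee_fin -!JE; apply: ge0_subset_integral => //.
  - exact: measurable_cube.
  - exact: measurable_cube.
  - by apply: measurable_funTS; exact/measurable_EFinP.
  - by move=> y _; rewrite lee_fin.
  - exact: cube_le.
have J0 r : 0 <= J r.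
  by apply/fine_ge0/integral_ge0 => y _; rewrite lee_fin.
have J1 r : J r <= 1.
  rewrite -lee_fin -JE; apply: le_trans ih1; apply: ge0_subset_integral => //.
  - exact: measurable_cube.
  - exact/measurable_EFinP.
  - by move=> y _; rewrite lee_fin.
pose S := [set r | 0 < r /\ T * r ^+ n <= J r].
have iT0 c : 0 <= c -> 0 <= c / T by move=> ?; rewrite divr_ge0// ltW.
have Sub r : S r -> r <= (1 / T) `^ n%:R^-1.
  move=> [r0 Tr]; rewrite -exprn_le_root ?(ltW r0) ?iT0// ler_pdivlMr// mulrC.
  exact: le_trans Tr (J1 r).
have [r1 Sr1] : S !=set0.
  (* With tolerance [h x - T] the mean over a small cube is at least [h x - (h x - T) = T], so [S]
     contains a positive radius. *)
  have e0 : 0 < h x - T by rewrite subr_gt0.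
  have [d d0 xd] := lx _ e0; exists (d / 2).
  have d2 : 0 < d / 2 by rewrite divr_gt0.
  have rd : 0 < d / 2 < d by rewrite d2/=; lra.
  split=> //; have mQ := measurable_cube (d / 2) x.
  have mhx : measurable_fun setT (fun y => (`|h y - h x|)%:E).
    exact: measurable_EFin_dist.
  have : (\int[mu]_(y in cube (d / 2) x) (h x)%:E <=
      \int[mu]_(y in cube (d / 2) x) ((h y)%:E + (`|h y - h x|)%:E))%E.
    apply: ge0_le_integral => //.
    - by move=> y _; rewrite lee_fin.
    - apply: measurable_funTS; apply: emeasurable_funD => //.
      exact/measurable_EFinP.
    - by move=> y _; rewrite -EFinD lee_fin; have := ler_norm (h x - h y); rewrite distrC; lra.
  rewrite ge0_integralD//; last 3 first.
  - by move=> y _; rewrite lee_fin.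
  - by apply: measurable_funTS; exact/measurable_EFinP.
  - exact: measurable_funTS.
  rewrite (integral_cube_cst _ _ (ltW d2)) JE => /le_trans/(_ (leeD2l _ (xd _ rd))).
  by rewrite -EFinD lee_fin; lra.
have hS : has_sup S by split; [exists r1|exists ((1 / T) `^ n%:R^-1) => r /Sub].
pose r := sup S.
have r0 : 0 < r.
  by apply: lt_le_trans (ub_le_sup hS.2 Sr1); have [] := Sr1.
(* The supremum belongs to [S]: each [s] in [S] satisfies [T s^n <= J s <= J r], a bound on [s] that
   the supremum inherits. *)
have Tr : T * r ^+ n <= J r.
  rewrite mulrC -ler_pdivlMr// exprn_le_root ?(ltW r0) ?iT0//.
  apply: ge_sup; first by exists r1.
  move=> s Ss; have [s0 Ts] := Ss; rewrite -exprn_le_root ?(ltW s0) ?iT0//.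
  rewrite ler_pdivlMr// mulrC; apply: le_trans Ts _; apply: J_nd.
  exact: (ub_le_sup hS.2 Ss).
have gtr s : r < s -> J s < T * s ^+ n.
  move=> rs; rewrite ltNge; apply/negP => Ts; move: (rs); apply/negP.
  rewrite -leNgt; apply: (ub_le_sup hS.2); split=> //.
  exact: lt_trans r0 _.
exists r; split => //.
- exact: le_trans Tr (J1 r).
- by rewrite JE lee_fin.
- move=> s; rewrite le_eqVlt JE lee_fin => /orP[/eqP <-|/gtr/ltW//].
  rewrite mulrC -ler_pdivrMr// root_le_exprn ?(ltW r0) ?iT0//.
  (* At [s = r] itself, let [e] tend to 0 in [J r <= J (r + e) < T (r + e)^n]. *)
  apply/ler_addgt0Pr => e e0; have re : r < r + e by rewrite ltrDl.
  rewrite -root_le_exprn ?(ltW (lt_trans r0 re)) ?iT0//.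
  rewrite ler_pdivrMr// mulrC; apply: le_trans (ltW (gtr _ re)).
  exact: J_nd (ltW re).
Qed.

End stopping.

Lemma measurable_ltr_nat d (T : measurableType d) (R : realType) (h : T -> R) (c : R) :
  measurable_fun setT h -> measurable_fun setT (fun x => (c < h x)%R%:R : R).
Proof.
move=> mh; rewrite (_ : (fun x => _) = \1_[set x | c < h x]).
  have mlt : measurable_fun setT (fun x => c < h x).
    exact: measurable_fun_ltr.
  apply: measurable_indic; rewrite -[X in measurable X]setTI.
  exact: (mlt measurableT [set true]).
apply/funext => x; rewrite indicE; congr (nat_of_bool _)%:R.
by apply/idP/idP => [|/set_mem]//; rewrite inE.
Qed.

Section parameters.
Context (R : realType) (n : nat) (q r0 : R) (omega : R -> R).
Hypotheses (n_gt0 : (0 < n)%N) (q_gt1 : 1 < q) (r0_gt0 : 0 < r0) (r0_lt1 : r0 < 1).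

Local Notation lambda0 := (Defs.lambda0 n q r0).
Local Notation afun := (Defs.afun n q r0 omega).

Lemma lambda0_gt1 : 1 < lambda0.
Proof.
have [q1 r00 r01] := And3 q_gt1 r0_gt0 r0_lt1.
have nq : 0 < n%:R / q by rewrite divr_gt0 ?ltr0n//; lra.
rewrite /Defs.lambda0 powRN -[ltLHS]invr1 ltf_pV2 ?posrE ?powR_gt0//.
rewrite [ltRHS](_ : 1 = 1 `^ (n%:R / q)); last by rewrite powR1.
by apply: gt0_ltr_powR; rewrite ?nnegrE// ltW.
Qed.

Lemma lambda0_powR : lambda0 `^ (- (q / n%:R)) = r0.
Proof.
have q1 := q_gt1.
have qN0 : q != 0 by rewrite gt_eqF//; lra.
have nN0 : n%:R != 0 :> R by rewrite pnatr_eq0 -lt0n.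
rewrite -powRrM mulrNN (_ : _ * _ = 1) ?powRr1 ?ltW//.
by field; rewrite qN0 nN0.
Qed.

Lemma level_radius_le lambda : lambda0 <= lambda -> lambda `^ (- (q / n%:R)) <= r0.
Proof.
have q1 := q_gt1.
move=> ll; rewrite -[leRHS]lambda0_powR !powRN.
have l0 : 0 < lambda0 by have := lambda0_gt1; lra.
rewrite lef_pV2 ?posrE ?powR_gt0//; last exact: lt_le_trans ll.
have qn : 0 <= q / n%:R by rewrite divr_ge0//; lra.
by apply: ge0_ler_powR => //; rewrite nnegrE ltW// (lt_le_trans l0).
Qed.

Lemma afun_ge1 lambda : (forall r, 0 <= r -> 0 <= omega r) -> 1 <= afun lambda.
Proof.
move=> omega_ge0; have l1 := lambda0_gt1; rewrite /Defs.afun; case: ifPn => ll.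
  have l1' : 1 <= lambda by lra.
  by rewrite -[leLHS](powRr0 lambda); apply: ler_powR => //; exact/omega_ge0/powR_ge0.
rewrite -[leLHS](powRr0 lambda0); apply: ler_powR; first exact: ltW.
exact/omega_ge0/ltW.
Qed.

End parameters.

Section level_set.
Context (R : realType) (n : nat) (q r0 c0 c1 l : R) (omega : R -> R)
  (f g : Rn R n -> R).
Hypotheses (n_gt0 : (0 < n)%N) (q_gt1 : 1 < q) (r0_gt0 : 0 < r0) (r0_lt1 : r0 < 1).
Hypothesis omega_ge0 : forall r, 0 <= r -> 0 <= omega r.
Hypothesis omega_nd : forall x y, 0 <= x -> x <= y -> omega x <= omega y.
Hypotheses (c0_gt0 : 0 < c0) (c1_gt0 : 0 < c1) (l_ge1 : 1 <= l).

Local Notation mu := (lebesgue_Rn R n).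

Hypotheses (mf : measurable_fun setT f) (mg : measurable_fun setT g).
Hypotheses (f_ge0 : forall x, 0 <= f x) (g_ge0 : forall x, 0 <= g x).
Hypotheses (ifq : mu.-integrable setT (fun x => (f x `^ q)%:E))
  (igq : mu.-integrable setT (fun x => (g x `^ q)%:E)).
Hypothesis fq1 : (\int[mu]_x (f x `^ q)%:E <= 1)%E.
Hypothesis reverse_hoelder : forall (r : R) (x0 : Rn R n), 0 < r <= r0 ->
  mean (cube r x0) (fun x => f x `^ q)
  <= c0 * mean (cube (l * r) x0) f `^ (q + omega r)
     + c1 * mean (cube (l * r) x0) (fun x => g x `^ q).

Local Notation lambda0 := (Defs.lambda0 n q r0).
Local Notation afun := (Defs.afun n q r0 omega).
Local Notation sfun := (Defs.sfun n q r0 omega).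

(** From [f <= f^q + 1] on a set of finite measure. *)
Lemma integrable_cube_fun r x : 0 <= r -> mu.-integrable (cube r x) (EFin \o f).
Proof.
move=> r_ge0; have mQ := measurable_cube r x.
apply: (@le_integrable _ _ _ mu _ mQ _ ((fun y => (f y `^ q)%:E) \+ cst 1%:E)%E).
- by apply/measurable_EFinP; exact: measurable_funTS.
- move=> y _; rewrite /= lee_fin !ger0_norm ?addr_ge0 ?powR_ge0//.
  have [f1|f1] := leP (f y) 1; first by rewrite ler_wpDl ?powR_ge0.
  by rewrite ler_wpDr// le1r_powR ?ltW.
- apply: integrableD => //; first exact: (integrable_cubeS _ _ ifq).
  apply/integrableP; split; first exact: measurable_cst.
  rewrite (_ : (fun _ => _) = fun=> 1%:E); last first.
    by apply/funext => y; rewrite /= normr1.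
  by rewrite integral_cube_cst ?ltry.
Qed.

(* Young's inequality replaces Jensen's. *)
Lemma mean_fun_le lambda r x : 0 < lambda -> 0 < r ->
  (\int[mu]_(y in cube r x) (f y `^ q)%:E <= (lambda `^ q * r ^+ n)%:E)%E ->
  mean (cube r x) f <= lambda.
Proof.
have q1 := q_gt1.
move=> l_gt0 r_gt0 fql; have mQ := measurable_cube r x.
have rn : 0 < r ^+ n by exact: exprn_gt0.
have qN0 : q != 0 by rewrite gt_eqF//; lra.
rewrite -(ler_pM2r rn) -lee_fin -mean_cube//; last exact: integrable_cube_fun (ltW r_gt0).
pose A := lambda * lambda `^ (- q) / q; pose B := (1 - q^-1) * lambda.
have A0 : 0 <= A by rewrite divr_ge0 ?mulr_ge0 ?powR_ge0 ?ltW//; lra.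
have B0 : 0 <= B by rewrite mulr_ge0 ?(ltW l_gt0)// subr_ge0 invf_le1; lra.
have mfq : measurable_fun setT (fun y => (f y `^ q)%:E) by exact: measurable_int ifq.
apply: (@le_trans _ _ (\int[mu]_(y in cube r x) (A%:E * (f y `^ q)%:E + B%:E))%E).
  apply: ge0_le_integral => //.
  - by move=> y _; rewrite lee_fin.
  - by apply: measurable_funTS; exact/measurable_EFinP.
  - apply: measurable_funTS; apply: emeasurable_funD; last exact: measurable_cst.
    exact: measurable_funeM.
  - by move=> y _; rewrite -EFinM -EFinD lee_fin; exact: le_mixed_powR.
rewrite ge0_integralD//; last 2 first.
- by move=> y _; rewrite -EFinM lee_fin mulr_ge0 ?powR_ge0.
- by apply: measurable_funTS; exact: measurable_funeM.
rewrite integral_cube_cst ?(ltW r_gt0)// ge0_integralZl//; last 2 first.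
- exact: measurable_funTS.
- by move=> y _; rewrite lee_fin powR_ge0.
apply: (@le_trans _ _ (A%:E * (lambda `^ q * r ^+ n)%:E + (B * r ^+ n)%:E)%E).
  by apply: leeD2r; apply: lee_wpmul2l.
rewrite -EFinM -EFinD lee_fin mulrA -mulrDl le_eqVlt; apply/orP; left; apply/eqP.
congr (_ * _); rewrite /A /B powRN; field.
by rewrite qN0 gt_eqF ?powR_gt0.
Qed.

(* The two thresholds are such that the discarded parts of [c0 a lambda^(q-1) f] and
   of [c1 g^q] are at most [lambda^q / 4] each. *)
Definition upper_part lambda (x : Rn R n) : R :=
  2 * c0 * (afun lambda * lambda `^ (q - 1)) *
    (f x * (sfun lambda / (4 * c0) < f x)%R%:R) +
  2 * c1 * (g x `^ q * (lambda / (4 * c1) `^ q^-1 < g x)%R%:R).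

Lemma measurable_upper_part lambda : measurable_fun setT (upper_part lambda).
Proof.
apply: measurable_funD; apply: measurable_funM => //; apply: measurable_funM => //.
- exact: measurable_ltr_nat.
- exact: (measurableT_comp (measurable_powR _)).
- exact: measurable_ltr_nat.
Qed.

Lemma upper_part_ge0 lambda x : 0 <= upper_part lambda x.
Proof.
have a0 : 0 <= afun lambda.
  by rewrite /Defs.afun; case: ifP => _; exact: powR_ge0.
by rewrite addr_ge0// !mulr_ge0 ?powR_ge0// ltW.
Qed.

(** The mean [m] of [f] over the enlarged cube is at most [lambda], so all but one power of [m] can
    be replaced by powers of [lambda], and the reverse Hoelder inequality becomes linear in [f]. The
    parts of [f] and [g^q] below the thresholds account for at most half of [lambda^q]; absorbing
    this half explains the factors 2 in [upper_part]. *)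
Lemma stopped_cube lambda r x : lambda0 <= lambda -> 0 < r ->
  lambda `^ q * r ^+ n <= 1 ->
  ((lambda `^ q * r ^+ n)%:E <= \int[mu]_(y in cube r x) (f y `^ q)%:E)%E ->
  (\int[mu]_(y in cube (l * r) x) (f y `^ q)%:E <=
    (lambda `^ q * (l * r) ^+ n)%:E)%E ->
  ((lambda `^ q * (l * r) ^+ n)%:E <=
    \int[mu]_(y in cube (l * r) x) (upper_part lambda y)%:E)%E.
Proof.
have [q1 lg1] := conj q_gt1 l_ge1.
move=> ll r_gt0 Tr1 frge flrle.
have l1 := lambda0_gt1 n_gt0 q_gt1 r0_gt0 r0_lt1.
have la_gt0 : 0 < lambda by lra.
pose T := lambda `^ q; have T0 : 0 < T by exact: powR_gt0.
have rl : r <= lambda `^ (- (q / n%:R)).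
  have -> : lambda `^ (- (q / n%:R)) = (T^-1) `^ n%:R^-1.
    by rewrite -powRN -powRrM mulNr.
  rewrite -exprn_le_root ?invr_ge0 ?(ltW r_gt0) ?(ltW T0)//.
  by rewrite -[leRHS]mul1r ler_pdivlMr// mulrC.
have rr0 : 0 < r <= r0.
  by rewrite r_gt0 (le_trans rl)// level_radius_le.
pose rho := l * r; have rho0 : 0 < rho by rewrite mulr_gt0//; lra.
pose m := mean (cube rho x) f; pose G := mean (cube rho x) (fun y => g y `^ q).
have m_le : m <= lambda by exact: mean_fun_le.
have m_ge0 : 0 <= m.
  apply: mulr_ge0; first by rewrite invr_ge0; exact: fine_ge0.
  by apply: Rintegral_ge0 => y _.
have a1 := afun_ge1 n_gt0 q_gt1 r0_gt0 r0_lt1 lambda omega_ge0.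
pose K := afun lambda * lambda `^ (q - 1).
have K0 : 0 < K by rewrite mulr_gt0 ?powR_gt0//; lra.
(* Since [r <= lambda^(-q/n)] and [omega] is non-decreasing, [lambda^(omega r)] is at most
   [a(lambda)]. *)
have mK : m `^ (q + omega r) <= K * m.
  have o0 := omega_ge0 (ltW r_gt0).
  have -> : m `^ (q + omega r) = m `^ (q - 1 + omega r) * m.
    have -> : q - 1 + omega r = q + omega r - 1 by ring.
    by rewrite [RHS]mulrC mulr_powRB1// ltr_pwDl// (lt_trans ltr01).
  rewrite ler_wpM2r//; apply: (@le_trans _ _ (lambda `^ (q - 1 + omega r))).
    by apply: ge0_ler_powR; rewrite ?nnegrE//; lra.
  rewrite powRD; last by apply/implyP => _; rewrite gt_eqF.
  rewrite /K mulrC ler_wpM2r ?powR_ge0//.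
  rewrite /Defs.afun ll; apply: ler_powR; first lra.
  exact: omega_nd (ltW r_gt0) rl.
have TmG : T <= c0 * (K * m) + c1 * G.
  apply: (@le_trans _ _ (mean (cube r x) (fun y => f y `^ q))).
    rewrite -(ler_pM2r (exprn_gt0 n r_gt0)) -lee_fin.
    by rewrite -(mean_cube r_gt0)//; exact: (integrable_cubeS _ _ ifq).
  apply: le_trans (reverse_hoelder x rr0) _.
  by rewrite lerD2r ler_pM2l.
have mQ := measurable_cube rho x.
have mUp := measurable_upper_part lambda.
have mgq : measurable_fun setT (fun y => (g y `^ q)%:E) by exact: measurable_int igq.
have mfE : measurable_fun setT (fun y => (f y)%:E) by exact/measurable_EFinP.
have c0K : 0 <= c0 * K by rewrite mulr_ge0// ltW.
have pointwise y : c0 * K * f y + c1 * g y `^ q <= upper_part lambda y / 2 + T / 2.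
  have fle : c0 * K * f y <=
      c0 * K * (f y * (sfun lambda / (4 * c0) < f y)%R%:R) + T / 4.
    have [_|fs] := ltP (sfun lambda / (4 * c0)) (f y).
      by rewrite mulr1 lerDl divr_ge0// ltW.
    rewrite mulr0 mulr0 add0r; apply: (le_trans (ler_wpM2l c0K fs)).
    (* By definition of [s], [a(lambda) lambda^(q-1) s(lambda) = lambda^q]. *)
    rewrite le_eqVlt; apply/orP; left; apply/eqP.
    rewrite /K /T -(@mulr_powRB1 _ lambda q) ?(ltW la_gt0) ?(lt_trans ltr01 q_gt1)//.
    rewrite /Defs.sfun; field; rewrite gt_eqF//= gt_eqF//.
    exact: (lt_le_trans ltr01 a1).
  have gle : c1 * g y `^ q <=
      c1 * (g y `^ q * (lambda / (4 * c1) `^ q^-1 < g y)%R%:R) + T / 4.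
    have [_|gs] := ltP (lambda / (4 * c1) `^ q^-1) (g y).
      by rewrite mulr1 lerDl divr_ge0// ltW.
    rewrite mulr0 mulr0 add0r.
    have c14 : 0 < 4 * c1 by rewrite mulr_gt0.
    have gT : g y `^ q <= T / (4 * c1).
      have sq : ((4 * c1) `^ q^-1) `^ q = 4 * c1.
        by rewrite -powRrM mulVf ?powRr1 ?(ltW c14)// gt_eqF// (lt_trans ltr01).
      have s_gt0 : 0 < (4 * c1) `^ q^-1 by rewrite powR_gt0.
      have ls0 : 0 <= lambda / (4 * c1) `^ q^-1 by rewrite divr_ge0// ltW.
      rewrite ler_pdivlMr// -[X in _ * X]sq.
      apply: (@le_trans _ _ ((lambda / (4 * c1) `^ q^-1) `^ q * ((4 * c1) `^ q^-1) `^ q)).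
        rewrite ler_wpM2r ?powR_ge0//; apply: ge0_ler_powR; rewrite ?nnegrE//.
        exact: (ltW (lt_trans ltr01 q_gt1)).
      by rewrite -powRM// ?divfK ?gt_eqF// ltW.
    apply: (le_trans (ler_wpM2l (ltW c1_gt0) gT)).
    by rewrite le_eqVlt; apply/orP; left; apply/eqP; field; rewrite gt_eqF.
  rewrite (le_trans (lerD fle gle))// le_eqVlt; apply/orP; left; apply/eqP.
  by rewrite /upper_part -/K; field.
have intI : ((T * rho ^+ n)%:E <=
    (2^-1)%:E * \int[mu]_(y in cube rho x) (upper_part lambda y)%:E
     + (T / 2 * rho ^+ n)%:E)%E.
  apply: (@le_trans _ _ (\int[mu]_(y in cube rho x)
      ((c0 * K)%:E * (f y)%:E + c1%:E * (g y `^ q)%:E))%E).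
    rewrite ge0_integralD//; last 4 first.
    - by move=> y _; rewrite -EFinM lee_fin mulr_ge0.
    - by apply: measurable_funTS; exact: measurable_funeM.
    - by move=> y _; rewrite -EFinM lee_fin mulr_ge0 ?powR_ge0 ?ltW.
    - by apply: measurable_funTS; exact: measurable_funeM.
    rewrite ge0_integralZl//; last 2 first.
    - exact: measurable_funTS.
    - by move=> y _; rewrite lee_fin.
    rewrite ge0_integralZl//; last 3 first.
    - exact: measurable_funTS.
    - by move=> y _; rewrite lee_fin powR_ge0.
    - by rewrite lee_fin ltW.
    have igQ : mu.-integrable (cube rho x) (EFin \o (fun y => g y `^ q)).
      exact: integrable_cubeS.
    rewrite (mean_cube rho0 igQ) (mean_cube rho0 (integrable_cube_fun x (ltW rho0))).
    rewrite -!EFinM -EFinD lee_fin -/m -/G.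
    rewrite (_ : _ + _ = (c0 * (K * m) + c1 * G) * rho ^+ n); last by ring.
    by rewrite ler_wpM2r// exprn_ge0// ltW.
  apply: (@le_trans _ _ (\int[mu]_(y in cube rho x)
      ((2^-1)%:E * (upper_part lambda y)%:E + (T / 2)%:E))%E).
    apply: ge0_le_integral => //.
    - move=> y _; rewrite -!EFinM -EFinD lee_fin.
      by apply: addr_ge0; rewrite mulr_ge0 ?powR_ge0 ?(ltW c1_gt0).
    - apply: measurable_funTS; apply: emeasurable_funD; exact: measurable_funeM.
    - apply: measurable_funTS; apply: emeasurable_funD => //.
      by apply: measurable_funeM; exact/measurable_EFinP.
    - by move=> y _; rewrite -!EFinM -!EFinD lee_fin [_^-1 * _]mulrC.
  rewrite ge0_integralD//; last 3 first.
  - by move=> y _; rewrite -EFinM lee_fin mulr_ge0// upper_part_ge0.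
  - by apply: measurable_funTS; apply: measurable_funeM; exact/measurable_EFinP.
  - by move=> y _; rewrite lee_fin divr_ge0// ltW.
  rewrite integral_cube_cst ?(ltW rho0)// ge0_integralZl//; last 2 first.
  - by apply: measurable_funTS; exact/measurable_EFinP.
  - by move=> y _; rewrite lee_fin upper_part_ge0.
have : (0 <= \int[mu]_(y in cube rho x) (upper_part lambda y)%:E)%E.
  by apply: integral_ge0 => y _; rewrite lee_fin upper_part_ge0.
move: intI; rewrite -/rho -/T.
(* The term [T / 2 * rho ^+ n] is subtracted only when the integral is finite; an infinite one makes
   the claim trivial. *)
case: (\int[mu]_(y in cube rho x) (upper_part lambda y)%:E)%E => [u| |//].
  by rewrite -EFinM -EFinD !lee_fin; lra.
by move=> _ _; exact: leey.
Qed.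

(** The covering is applied to the enlarged cubes, of edge [l * rho x]. The upper bound on the
    triple and the lower bound of [stopped_cube] both carry [(l * rho x)^n], so only [3^n]
    survives. *)
Lemma level_set_integral lambda : lambda0 <= lambda ->
  (\int[mu]_x (f x `^ q * (lambda < f x)%R%:R)%:E <=
    (3 ^+ n)%:E * \int[mu]_x (upper_part lambda x)%:E)%E.
Proof.
move=> ll; have l1 := lambda0_gt1 n_gt0 q_gt1 r0_gt0 r0_lt1.
have la_gt0 : 0 < lambda by lra.
have T0 : 0 < lambda `^ q by exact: powR_gt0.
have q0 : 0 < q := lt_trans ltr01 q_gt1.
have lg0 : 0 < l := lt_le_trans ltr01 l_ge1.
have mfq : measurable_fun setT (fun x => f x `^ q).
  by apply/measurable_EFinP; exact: measurable_int ifq.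
have mUp : measurable_fun setT (EFin \o upper_part lambda).
  by apply/measurable_EFinP; exact: measurable_upper_part.
have n3 : 0 <= 3 ^+ n :> R by exact: exprn_ge0.
pose X := [set x | lebesgue_point (fun x => f x `^ q) x /\ lambda < f x].
have stop x : exists r, X x -> [/\ 0 < r, lambda `^ q * r ^+ n <= 1,
    ((lambda `^ q * r ^+ n)%:E <= \int[mu]_(y in cube r x) (f y `^ q)%:E)%E &
    forall s, r <= s -> (\int[mu]_(y in cube s x) (f y `^ q)%:E <=
      (lambda `^ q * s ^+ n)%:E)%E].
  have [[lx lf]|nX] := pselect (X x); last by exists 0.
  have [||r rP] := @stopping_radius _ _ (fun x => f x `^ q) x (lambda `^ q)
    n_gt0 _ ifq fq1 lx T0.
  - by move=> y; exact: powR_ge0.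
  - by apply: gt0_ltr_powR; rewrite ?nnegrE ?f_ge0 ?(ltW la_gt0).
  - by exists r.
have {stop}/choice[rho rhoP] := stop.
have [||||x /rhoP[r0' _ _ _]|x /rhoP[r0' Tr frge frle]|U [mU XU] intU] :=
  @covering_integral R n (fun x => l * rho x) X
    (fun x => (f x `^ q)%:E) (fun x => (3 ^+ n)%:E * (upper_part lambda x)%:E)%E.
- exact/measurable_EFinP.
- exact: measurable_funeM.
- by move=> x; rewrite lee_fin powR_ge0.
- by move=> x; rewrite mule_ge0// lee_fin upper_part_ge0.
- exact: mulr_gt0.
- have rl : rho x <= l * rho x by rewrite ler_peMl// ltW.
  (* The triple is still larger than the stopping radius, so its mean is at most [lambda^q]. *)
  apply: (@le_trans _ _ (lambda `^ q * (3 * (l * rho x)) ^+ n)%:E).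
    apply: frle; apply: le_trans rl _; rewrite ler_peMl//.
      by rewrite mulr_ge0// ltW.
    by rewrite (_ : 1 = 1%:R)// ler_nat.
  have mQ := measurable_cube (l * rho x) x.
  rewrite ge0_integralZl//; last 2 first.
  + exact: measurable_funTS.
  + by move=> y _; rewrite lee_fin upper_part_ge0.
  rewrite exprMn mulrCA EFinM lee_wpmul2l//.
  exact: stopped_cube (frle _ rl).
apply: (@le_trans _ _ (\int[mu]_(x in U) (f x `^ q)%:E)%E).
  rewrite [leRHS]integral_mkcond.
  have mI : measurable_fun setT (fun x => (lambda < f x)%R%:R : R).
    exact: measurable_ltr_nat.
  apply: ae_ge0_le_integral => //.
  - by move=> x _; rewrite lee_fin mulr_ge0 ?powR_ge0.
  - by apply/measurable_EFinP; exact: measurable_funM.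
  - by move=> x _; apply: erestrict_ge0 => y _; rewrite lee_fin powR_ge0.
  - apply/(measurable_restrictT (fun x => (f x `^ q)%:E)) => //.
    by apply: measurable_funTS; exact/measurable_EFinP.
  - apply: negligibleS (lebesgue_differentiation_Rn ifq) => x /=.
    apply: contra_not => lx _; have [fl|_] := ltP lambda (f x); last first.
      by rewrite mulr0; apply: erestrict_ge0 => y _; rewrite lee_fin powR_ge0.
    by rewrite mulr1 patchE mem_set//; apply: XU.
apply: le_trans intU _.
rewrite ge0_integralZl//.
by move=> x _; rewrite lee_fin upper_part_ge0.
Qed.

End level_set.

(** * The functions s and phi *)

Section primitive.
Context (R : realType) (v : R -> R) (m : R).
Hypothesis v_cont : continuous v.

Local Notation mu := (@lebesgue_measure R).

Definition primitive (x : R) := \int[mu]_(t in `[m, x]) v t.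

Lemma integrable_segment a b : mu.-integrable `[a, b] (EFin \o v).
Proof.
apply: continuous_compact_integrable; first exact: segment_compact.
exact: continuous_subspaceT.
Qed.

Lemma is_derive_primitive x : m < x -> is_derive x 1 primitive (v x).
Proof.
move=> mx; have xx : x < x + 1 by rewrite ltrDl.
have [dF F'] := continuous_FTC1_closed xx (integrable_segment m (x + 1)) mx (@v_cont x).
by split => //; rewrite -derive1E.
Qed.

Lemma primitiveB a b : m <= a -> a <= b ->
  primitive b - primitive a = \int[mu]_(t in `[a, b]) v t.
Proof.
move=> ma ab; rewrite /primitive Rintegral_itvB ?bnd_simp//.
  apply: Rintegral_itv_obnd_cbnd; apply: integrableS (integrable_segment a b) => //.
  exact: subset_itv_oc_cc.
exact: integrable_segment.
Qed.

Lemma is_derive_expR_primitive (c x0 x : R) : m < x ->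
  is_derive x 1 (fun y => expR (c * (primitive y - x0)))
    (c * v x * expR (c * (primitive x - x0))).
Proof.
move=> mx; have dP := is_derive_primitive mx.
have H : is_derive x 1 (fun y => c *: (primitive y - x0)) (c *: (v x - 0)).
  exact: is_deriveZ.
have := @is_derive1_comp _ expR (fun y => c * (primitive y - x0)) x _ _
  (is_derive_expR _) H.
by rewrite subr0 mulrC.
Qed.

Lemma integral_expR_primitive (c x0 a b : R) : m < a -> a <= b ->
  (\int[mu]_(x in `[a, b]) (c * v x * expR (c * (primitive x - x0)))%:E =
   (expR (c * (primitive b - x0)))%:E - (expR (c * (primitive a - x0)))%:E)%E.
Proof.
move=> ma; rewrite le_eqVlt => /predU1P[<-|ab].
  by rewrite set_itv1 integral_set1 subee.
have dF x : m < x -> is_derive x 1 (fun y => expR (c * (primitive y - x0)))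
    (c * v x * expR (c * (primitive x - x0))) by exact: is_derive_expR_primitive.
have cF x : m < x -> {for x, continuous (fun y => expR (c * (primitive y - x0)))}.
  move=> /dF[+ _]; move=> /derivable1_diffP; exact: differentiable_continuous.
have cint x : m < x -> {for x, continuous (fun x => c * v x * expR (c * (primitive x - x0)))}.
  move=> mx; apply: cvgM; last exact: cF.
  by apply: cvgM; [exact: cvg_cst|exact: v_cont].
rewrite (@continuous_FTC2 _ (fun x => c * v x * expR (c * (primitive x - x0)))
  (fun y => expR (c * (primitive y - x0))) _ _ ab)//.
- apply: continuous_in_subspaceT => x; rewrite inE/= in_itv/= => /andP[ax _].
  by apply: cint; exact: lt_le_trans ax.
- split.
  + move=> x; rewrite in_itv/= => /andP[ax _].
    by have [] := dF _ (lt_trans ma ax).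
  + by apply: cvg_at_right_filter; exact: cF.
  + by apply: cvg_at_left_filter; apply: cF; exact: lt_trans ab.
- move=> x; rewrite in_itv/= => /andP[ax _].
  by have [_ <-] := dF _ (lt_trans ma ax); rewrite derive1E.
Qed.

End primitive.

Lemma integral_powR (R : realType) (p a b : R) : 0 < p -> 0 < a -> a <= b ->
  (\int[lebesgue_measure]_(x in `[a, b]) (p * x `^ (p - 1))%:E =
   (b `^ p - a `^ p)%:E)%E.
Proof.
move=> p0 a0; rewrite le_eqVlt => /predU1P[<-|ab].
  by rewrite set_itv1 integral_set1 subrr.
have cP (r x : R) : 0 < x -> {for x, continuous (fun y : R => y `^ r)}.
  move=> x_gt0; have : derivable (fun y : R => y `^ r) x 1.
    by apply: derivable_powR; rewrite in_itv/= x_gt0.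
  by move=> /derivable1_diffP; exact: differentiable_continuous.
rewrite EFinB (@continuous_FTC2 _ (fun x => p * x `^ (p - 1)) (fun y : R => y `^ p) _ _ ab)//.
- apply: continuous_in_subspaceT => x; rewrite inE/= in_itv/= => /andP[ax _].
  apply: cvgM; first exact: cvg_cst.
  by apply: cP; exact: lt_le_trans ax.
- split.
  + move=> x; rewrite in_itv/= => /andP[ax _].
    by apply: derivable_powR; rewrite in_itv/= (lt_trans a0).
  + by apply: cvg_at_right_filter; exact: cP.
  + by apply: cvg_at_left_filter; apply: cP; exact: lt_trans ab.
- move=> x; rewrite in_itv/= => /andP[ax _].
  by apply: powR_derive1; rewrite in_itv/= (lt_trans a0).
Qed.

Section weight.
Context (R : realType) (n : nat) (q r0 : R) (omega : R -> R).
Hypotheses (n_gt0 : (0 < n)%N) (q_gt1 : 1 < q) (r0_gt0 : 0 < r0) (r0_lt1 : r0 < 1).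
Hypothesis omega_ge0 : forall r, 0 <= r -> 0 <= omega r.
Hypothesis omega_nd : forall x y, 0 <= x -> x <= y -> omega x <= omega y.
Hypothesis omega_cont : {within `[0, +oo[, continuous omega}.
Hypothesis omega0_lt1 : omega0 r0 omega < 1.

Local Notation lambda0 := (Defs.lambda0 n q r0).
Local Notation afun := (Defs.afun n q r0 omega).
Local Notation sfun := (Defs.sfun n q r0 omega).
Local Notation weight := (Defs.weight n q r0 omega).
Local Notation s0 := (Defs.s0 n q r0 omega).
Local Notation lambdafun := (Defs.lambdafun n q r0 omega).
Local Notation omega0 := (Defs.omega0 r0 omega).

Let lambda0_gt1 := lambda0_gt1 n_gt0 q_gt1 r0_gt0 r0_lt1.
Let lambda0_gt0 : 0 < lambda0 := lt_trans ltr01 lambda0_gt1.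
Let q_gt0 : 0 < q := lt_trans ltr01 q_gt1.
Let afun_ge1 t : 1 <= afun t := afun_ge1 n_gt0 q_gt1 r0_gt0 r0_lt1 t omega_ge0.
Let afun_gt0 t : 0 < afun t := lt_le_trans ltr01 (afun_ge1 t).

Lemma s0_gt0 : 0 < s0.
Proof. exact: powR_gt0. Qed.

(** A single formula in [max(t, lambda0)] for both branches: continuity, including that at
    [lambda0], becomes a composition. *)
Lemma afunE t : afun t =
  Num.max t lambda0 `^ omega (Num.max t lambda0 `^ (- (q / n%:R))).
Proof.
rewrite /Defs.afun; case: leP => // _.
by rewrite /Defs.omega0 lambda0_powR.
Qed.

Lemma continuous_afun : continuous afun.
Proof.
move=> t; pose M (u : R) := Num.max u lambda0.
have M_gt0 u : 0 < M u by rewrite /M lt_max lambda0_gt0 orbT.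
have -> : afun = (fun u => expR (omega (expR (- (q / n%:R) * ln (M u))) * ln (M u))).
  by apply/funext => u; rewrite afunE -/(M u) /powR !gt_eqF.
have cM : M u @[u --> t] --> M t.
  apply: (@continuous_max _ _ (fun u : R => u) (fun=> lambda0) t).
    exact: cvg_id.
  exact: cvg_cst.
have clM : ln (M u) @[u --> t] --> ln (M t).
  by apply: continuous_cvg cM; exact: continuous_ln.
apply: continuous_cvg; first exact: continuous_expR.
apply: cvgM => //; apply: continuous_cvg.
  move/continuous_within_itvcyP : omega_cont => [+ _]; apply.
  by rewrite in_itv/= expR_gt0.
apply: continuous_cvg; first exact: continuous_expR.
by apply: cvgM => //; exact: cvg_cst.
Qed.

Lemma weight_ge0 t : 0 <= t -> 0 <= weight t.
Proof. by move=> t0; rewrite invr_ge0 mulr_ge0// powR_ge0. Qed.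

Lemma weight_le t : 0 < t -> weight t <= t^-1.
Proof.
move=> t0; rewrite /Defs.weight lef_pV2 ?posrE ?mulr_gt0 ?powR_gt0//.
rewrite ler_peMr ?(ltW t0)//.
rewrite -[leLHS](powRr0 (afun t)); apply: ler_powR => //; exact: ltW.
Qed.

(** The second factor is non-decreasing, its base being at least 1 and its exponent non-negative and
    non-decreasing in [t]; this gives [sfun_growth]. *)
Lemma powR_s (t : R) : lambda0 <= t ->
  sfun t = t `^ (1 - omega0) * t `^ (omega0 - omega (t `^ (- (q / n%:R)))).
Proof.
move=> lt0; have t0 : 0 < t := lt_le_trans lambda0_gt0 lt0.
rewrite -powRD; last by apply/implyP => _; rewrite gt_eqF.
rewrite addrA subrK powRB; last by apply/implyP => _; rewrite gt_eqF.
by rewrite powRr1 ?(ltW t0)// /Defs.sfun /Defs.afun lt0.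
Qed.

(* Replaces [(log s)' >= (1 - omega0) / lambda]; needs no derivative of [omega]. *)
Lemma sfun_growth t u : lambda0 <= t -> t <= u ->
  sfun t <= sfun u * (t / u) `^ (1 - omega0).
Proof.
move=> lt0 tu; have t0 : 0 < t := lt_le_trans lambda0_gt0 lt0.
have u0 : 0 < u := lt_le_trans t0 tu.
have t1 : 1 <= t := le_trans (ltW lambda0_gt1) lt0.
have lu0 : lambda0 <= u := le_trans lt0 tu.
rewrite !powR_s// powRM ?invr_ge0 ?(ltW t0) ?(ltW u0)//.
set e := omega (u `^ _); set d := omega (t `^ _).
have uE : u `^ (1 - omega0) * u^-1 `^ (1 - omega0) = 1.
  by rewrite -powRM ?invr_ge0 ?(ltW u0)// divff ?gt_eqF// powR1.
rewrite (_ : _ * _ * (_ * _) = t `^ (1 - omega0) * u `^ (omega0 - e) *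
    (u `^ (1 - omega0) * u^-1 `^ (1 - omega0))); last by ring.
rewrite uE mulr1 ler_wpM2l ?powR_ge0//.
have qn : 0 <= q / n%:R by rewrite divr_ge0// ltW.
have ed : e <= d.
  apply: omega_nd; first exact: powR_ge0.
  by rewrite !powRN lef_pV2 ?posrE ?powR_gt0//; apply: ge0_ler_powR; rewrite ?nnegrE// ltW.
have e0 : e <= omega0.
  apply: omega_nd; first exact: powR_ge0.
  exact: level_radius_le.
apply: (@le_trans _ _ (t `^ (omega0 - e))).
  by apply: ler_powR => //; rewrite lerD2l lerN2.
by apply: ge0_ler_powR; rewrite ?subr_ge0 ?nnegrE// ltW.
Qed.

Lemma sfun_gt0 t : 0 < t -> 0 < sfun t.
Proof. by move=> t0; rewrite divr_gt0. Qed.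

Lemma sfun_lt t u : lambda0 <= t -> t < u -> sfun t < sfun u.
Proof.
move=> lt0 tu; have t0 : 0 < t := lt_le_trans lambda0_gt0 lt0.
have u0 : 0 < u := lt_trans t0 tu.
apply: le_lt_trans (sfun_growth lt0 (ltW tu)) _.
rewrite gtr_pMr ?sfun_gt0//.
rewrite [ltRHS](_ : 1 = 1 `^ (1 - omega0)); last by rewrite powR1.
apply: gt0_ltr_powR; rewrite ?subr_gt0 ?nnegrE ?divr_ge0 ?(ltW t0) ?(ltW u0)//.
by rewrite ltr_pdivrMr// mul1r.
Qed.

Lemma sfun_lambda0 : sfun lambda0 = s0.
Proof.
rewrite powR_s// /Defs.s0 lambda0_powR// [in X in _ * X]/Defs.omega0 subrr.
by rewrite powRr0 mulr1.
Qed.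

Lemma sfun_le t : 0 <= t -> sfun t <= t.
Proof. by move=> t0; rewrite ler_pdivrMr// ler_peMr. Qed.

Lemma sfun_ge_s0 t : lambda0 <= t -> s0 <= sfun t.
Proof.
rewrite -sfun_lambda0 le_eqVlt => /predU1P[<-//|lt]; apply/ltW; exact: sfun_lt.
Qed.

Lemma lambdafunP y : s0 <= y -> lambda0 <= lambdafun y /\ sfun (lambdafun y) = y.
Proof.
move=> sy; have y0 : 0 < y := lt_le_trans s0_gt0 sy.
have [z lz sz] : exists2 z, lambda0 <= z & sfun z = y.
  (* By [sfun_growth] from [lambda0], [s(lambda0 D) >= s0 D^(1 - omega0)], which is at least [y] for
     this [D]; the intermediate value theorem then applies on [[lambda0, lambda0 D]]. *)
  pose D := Num.max 1 ((y / s0) `^ (1 - omega0)^-1).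
  have p0 : 0 < 1 - omega0 by rewrite subr_gt0.
  have D1 : 1 <= D by rewrite le_max lexx.
  have D0 : 0 < D by rewrite (lt_le_trans ltr01).
  have lD : lambda0 <= lambda0 * D by rewrite ler_peMr// ltW.
  have yD : y <= sfun (lambda0 * D).
    have := sfun_growth (lexx lambda0) lD; rewrite sfun_lambda0.
    rewrite invfM mulrA divff ?gt_eqF// mul1r => sD.
    have D_ge : y / s0 <= D `^ (1 - omega0).
      have -> : y / s0 = ((y / s0) `^ (1 - omega0)^-1) `^ (1 - omega0).
        by rewrite -powRrM mulVf ?gt_eqF// powRr1// divr_ge0// ltW// s0_gt0.
      apply: ge0_ler_powR; rewrite ?nnegrE ?powR_ge0 ?(ltW p0) ?(ltW D0)//.
      by rewrite le_max lexx orbT.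
    have DD : D `^ (1 - omega0) * D^-1 `^ (1 - omega0) = 1.
      by rewrite -powRM ?invr_ge0 ?(ltW D0)// divff ?gt_eqF// powR1.
    rewrite -[leLHS](divfK (lt0r_neq0 s0_gt0)).
    apply: (le_trans (ler_wpM2l _ sD)); first by rewrite divr_ge0 ?ltW// s0_gt0.
    rewrite mulrCA ler_piMr ?(ltW (sfun_gt0 _)) ?mulr_gt0//.
    by rewrite -[leRHS]DD ler_wpM2r// powR_ge0.
  have [||z zi <-] := @IVT _ sfun _ _ y lD; last 2 first.
  - rewrite sfun_lambda0 ge_min le_max sy yD orbT//.
  - by exists z => //; move: zi; rewrite in_itv/= => /andP[].
  apply: continuous_subspaceT => x; apply: cvgM; first exact: cvg_id.
  by apply: cvgV; [rewrite gt_eqF|exact: continuous_afun].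
have inj : {in `[lambda0, +oo[%classic &, injective sfun}.
  move=> t u; rewrite !inE/= !in_itv/= !andbT => lt lu tu.
  by case: (ltgtP t u) => // [/(sfun_lt lt)|/(sfun_lt lu)]; rewrite tu ltxx.
have zi : z \in `[lambda0, +oo[%classic by rewrite inE/= in_itv/= lz.
by rewrite -sz /Defs.lambdafun pinvKV.
Qed.

End weight.

(** * Growth of phi and integrals against its derivative *)

Lemma le_integral_support d (T : measurableType d) (R : realType)
    (mu : {measure set T -> \bar R}) (A B : set T) (f g : T -> \bar R) :
  measurable A -> measurable B -> measurable_fun A f -> measurable_fun B g ->
  (forall x, A x -> 0 <= f x)%E -> (forall x, B x -> 0 <= g x)%E ->
  (forall x, A x -> f x = 0 \/ (B x /\ f x <= g x))%E ->
  (\int[mu]_(x in A) f x <= \int[mu]_(x in B) g x)%E.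
Proof.
move=> mA mB mf mg f0 g0 fg.
rewrite integral_mkcond [leRHS]integral_mkcond; apply: ge0_le_integral => //.
- by move=> x _; exact: erestrict_ge0.
- exact/(measurable_restrictT f).
- exact/(measurable_restrictT g).
- move=> x _; rewrite [leLHS]patchE; case: ifPn => [/set_mem Ax|_].
    by have [->|[Bx ?]] := fg _ Ax; [exact: erestrict_ge0|rewrite patchE mem_set].
  exact: erestrict_ge0.
Qed.

Section phi.
Context (R : realType) (n : nat) (q r0 k theta : R) (omega phi : R -> R).
Hypotheses (n_gt0 : (0 < n)%N) (q_gt1 : 1 < q) (r0_gt0 : 0 < r0) (r0_lt1 : r0 < 1).
Hypothesis omega_ge0 : forall r, 0 <= r -> 0 <= omega r.
Hypothesis omega_nd : forall x y, 0 <= x -> x <= y -> omega x <= omega y.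
Hypothesis omega_cont : {within `[0, +oo[, continuous omega}.
Hypothesis omega0_lt1 : omega0 r0 omega < 1.
Hypotheses (k_gt0 : 0 < k) (theta_gt0 : 0 < theta).

Local Notation lambda0 := (Defs.lambda0 n q r0).
Local Notation afun := (Defs.afun n q r0 omega).
Local Notation sfun := (Defs.sfun n q r0 omega).
Local Notation weight := (Defs.weight n q r0 omega).
Local Notation s0 := (Defs.s0 n q r0 omega).
Local Notation lambdafun := (Defs.lambdafun n q r0 omega).
Local Notation omega0 := (Defs.omega0 r0 omega).
Local Notation Mfun := (Defs.Mfun n q r0 omega).
Local Notation mu := (@lebesgue_measure R).

Hypothesis phi_gt0 : forall s, 0 <= s -> 0 < phi s.
Hypothesis phi_incr : forall s t, 0 <= s -> s <= t -> phi s <= phi t.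
Hypothesis phi_eq : forall s, s0 / k <= s ->
  phi s = expR (theta * (1 - omega0) * oint (s0 / k) s weight).

Let lambda0_gt1 := lambda0_gt1 n_gt0 q_gt1 r0_gt0 r0_lt1.
Let lambda0_gt0 : 0 < lambda0 := lt_trans ltr01 lambda0_gt1.
Let q_gt0 : 0 < q := lt_trans ltr01 q_gt1.
Let afun_ge1 t : 1 <= afun t := afun_ge1 n_gt0 q_gt1 r0_gt0 r0_lt1 t omega_ge0.
Let afun_gt0 t : 0 < afun t := lt_le_trans ltr01 (afun_ge1 t).
Let b0 := s0 / k.
Let b0_gt0 : 0 < b0. Proof. by rewrite divr_gt0// s0_gt0. Qed.
Let c := theta * (1 - omega0).
Let c_gt0 : 0 < c. Proof. by rewrite mulr_gt0// subr_gt0. Qed.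

(** The weight is changed only to the left of [b0], so as to be continuous on the whole line, past
    the singularity at 0. *)
Let weight_ext (t : R) := (Num.max t b0 * afun t `^ q)^-1.

Let weight_extE t : b0 <= t -> weight_ext t = weight t.
Proof. by rewrite /weight_ext => /max_idPl ->. Qed.

Let continuous_weight_ext : continuous weight_ext.
Proof.
move=> t.
have M0 : 0 < Num.max t b0 by rewrite lt_max b0_gt0 orbT.
apply: cvgV; first by rewrite gt_eqF// mulr_gt0// powR_gt0.
apply: cvgM.
  apply: (@continuous_max _ _ (fun u : R => u) (fun=> b0) t).
    exact: cvg_id.
  exact: cvg_cst.
have -> : (fun u => afun u `^ q) = (fun u => expR (q * ln (afun u))).
  by apply/funext => u; rewrite /powR gt_eqF.
rewrite (_ : afun t `^ q = expR (q * ln (afun t))); last by rewrite /powR gt_eqF.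
apply: continuous_cvg; first exact: continuous_expR.
apply: cvgM; first exact: cvg_cst.
apply: continuous_cvg; first exact: continuous_ln.
exact: continuous_afun.
Qed.

(** Starting to the left of [b0] makes the primitive differentiable at [b0] itself. *)
Let P := primitive weight_ext (b0 - 1).
Let b01 : b0 - 1 < b0. Proof. by rewrite ltrBlDr ltrDl. Qed.

Lemma oint_primitive s t : b0 <= s -> s <= t -> oint s t weight = P t - P s.
Proof.
move=> bs st; rewrite /oint st /P primitiveB//; last exact: (le_trans (ltW b01)).
apply: eq_Rintegral => x; rewrite inE/= in_itv/= => /andP[sx _].
by rewrite weight_extE// (le_trans bs).
Qed.

Lemma phi_primitive s : b0 <= s -> phi s = expR (c * (P s - P b0)).
Proof. by move=> bs; rewrite phi_eq// oint_primitive. Qed.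

Lemma phi_ratio s t : b0 <= s -> s <= t ->
  phi t = phi s * expR (c * oint s t weight).
Proof.
move=> bs st; rewrite !phi_primitive ?(le_trans bs)// oint_primitive// -expRD.
by congr expR; ring.
Qed.

Lemma phi_integral s t : b0 <= s -> s <= t ->
  (\int[mu]_(x in `[s, t]) (c * weight x * phi x)%:E = (phi t - phi s)%:E)%E.
Proof.
move=> bs st; rewrite !phi_primitive ?(le_trans bs)// EFinB.
rewrite -(@integral_expR_primitive _ _ (b0 - 1) continuous_weight_ext c (P b0) s t)//; last first.
  exact: lt_le_trans b01 bs.
apply: eq_integral => x; rewrite inE/= in_itv/= => /andP[sx _].
by rewrite weight_extE ?phi_primitive// (le_trans bs).
Qed.

Lemma oint_weight_ge0 s t : 0 <= s -> s <= t -> 0 <= oint s t weight.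
Proof.
move=> hs st; rewrite /oint st; apply: Rintegral_ge0 => x /=.
by rewrite in_itv/= => /andP[sx _]; apply: weight_ge0; exact: le_trans hs sx.
Qed.

Lemma oint_weight_le s t : b0 <= s -> s <= t -> oint s t weight <= (t - s) / s.
Proof.
move=> bs st; have hs : 0 < s := lt_le_trans b0_gt0 bs.
rewrite /oint st.
have -> : \int[mu]_(x in `[s, t]) weight x = \int[mu]_(x in `[s, t]) weight_ext x.
  apply: eq_Rintegral => x; rewrite inE/= in_itv/= => /andP[sx _].
  by rewrite weight_extE// (le_trans bs).
have -> : (t - s) / s = \int[mu]_(x in `[s, t]) s^-1.
  rewrite Rintegral_cst// mulrC; congr (_ * _).
  have := lebesgue_measure_itv `[s, t]; rewrite /= lte_fin => ->.
  case: ltP => //= ts.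
  by have -> : s = t; [exact: le_anti (introT andP (conj st ts))|rewrite subrr].
apply: le_Rintegral => //.
- exact: integrable_segment.
- by apply: (@integrable_segment _ (fun=> s^-1)) => x; exact: cvg_cst.
- move=> x; rewrite /= in_itv/= => /andP[sx _].
  rewrite weight_extE ?(le_trans bs)//.
  have x0 : 0 < x := lt_le_trans hs sx.
  by apply: le_trans (weight_le _ _ _ _ _ x0) _; rewrite // lef_pV2.
Qed.

(** For [s >= b0] the weight is at most [1/s] on [[s, D s]], so [phi] grows at most by
    [exp(c (D - 1))]. For [s < b0] monotonicity traps both values between [phi 0] and [phi (D b0)].
    The constant is the sum of the two bounds. *)
Lemma phi_doubling (D : R) : 1 <= D -> exists2 C : R, 0 < C &
  forall s, 0 <= s -> phi (D * s) <= C * phi s.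
Proof.
move=> D1; have D0 : 0 < D := lt_le_trans ltr01 D1.
exists (expR (c * (D - 1)) + phi (D * b0) / phi 0).
  by rewrite addr_gt0 ?expR_gt0// divr_gt0// phi_gt0// mulr_ge0// ltW.
move=> s hs; rewrite mulrDl.
have phis := phi_gt0 hs.
have [bs|sb] := leP b0 s.
  have sDs : s <= D * s by rewrite ler_peMl.
  rewrite (phi_ratio bs sDs) ler_wpDr//.
    by rewrite mulr_ge0 ?divr_ge0// ltW// phi_gt0// mulr_ge0// ltW.
  rewrite mulrC ler_wpM2r ?(ltW phis)// ler_expR ler_wpM2l ?(ltW c_gt0)//.
  apply: le_trans (oint_weight_le bs sDs) _.
  have s0' : 0 < s := lt_le_trans b0_gt0 bs.
  by rewrite ler_pdivrMr// mulrBl mul1r.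
rewrite ler_wpDl ?mulr_ge0 ?expR_ge0 ?(ltW phis)//.
apply: (@le_trans _ _ (phi (D * b0))).
  by apply: phi_incr; [rewrite mulr_ge0// ltW|rewrite ler_wpM2l// ltW].
have Db0 : 0 < phi (D * b0) by rewrite phi_gt0// mulr_ge0// ltW.
rewrite mulrAC -mulrA (ler_peMr (ltW Db0))//.
by rewrite ler_pdivlMr ?mul1r ?phi_incr// phi_gt0.
Qed.

Lemma oint_le_Mfun s : Mfun k \is a fin_num -> b0 <= s ->
  oint s (lambdafun (k * s)) weight <= fine (Mfun k).
Proof.
move=> Mfin bs; rewrite -lee_fin fineK//; apply: ereal_sup_ubound.
by exists s => //=; rewrite in_itv/= bs.
Qed.

(** On [[b0, +oo[] this is the derivative of the exponential formula for [phi]. *)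
Definition phi_density (x : R) := theta * (1 - omega0) * weight x * phi x.

Lemma phi_density_ge0 x : 0 <= x -> 0 <= phi_density x.
Proof.
move=> x0; rewrite mulr_ge0 ?(ltW (phi_gt0 x0))// mulr_ge0 ?(ltW c_gt0)//.
exact: weight_ge0.
Qed.

Lemma measurable_phi_pos : measurable_fun setT (fun x : R => phi (Num.max 0 x)).
Proof.
apply: nondecreasing_measurable => // x y xy; apply: phi_incr.
  by rewrite le_max lexx.
by rewrite ge_max !le_max lexx xy orbT.
Qed.

Lemma measurable_phi_comp d (T : measurableType d) (h : T -> R) :
  measurable_fun setT h -> (forall x, 0 <= h x) ->
  measurable_fun setT (fun x => phi (h x)).
Proof.
move=> mh h0; rewrite (_ : (fun x => _) = (fun y => phi (Num.max 0 y)) \o h).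
  by apply: measurableT_comp; first exact: measurable_phi_pos.
by apply/funext => x /=; have /max_r -> := h0 x.
Qed.

Lemma measurable_phi_density : measurable_fun `[b0, +oo[ phi_density.
Proof.
apply: (@eq_measurable_fun _ _ _ _ _ (fun x : R => c * weight_ext x * phi (Num.max 0 x))).
  move=> x; rewrite inE/= in_itv/= andbT => bx; rewrite /phi_density weight_extE//.
  by have /max_r -> : 0 <= x by exact: le_trans (ltW b0_gt0) bx.
apply: measurable_funTS; apply: measurable_funM; last exact: measurable_phi_pos.
apply: measurable_funM => //; exact: continuous_measurable_fun.
Qed.

Hypothesis k_ge1 : 1 <= k.

(** From [s0 = s(lambda0) <= lambda0] and [k >= 1]. All levels from [lambda0] on thus lie where
    [phi] has its exponential formula. *)
Lemma b0_le_lambda0 : b0 <= lambda0.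
Proof.
rewrite /b0 ler_pdivrMr//; apply: (@le_trans _ _ lambda0).
  by rewrite -(sfun_lambda0 omega n_gt0 q_gt1 r0_gt0 r0_lt1) sfun_le// ltW.
by rewrite ler_peMr// ltW.
Qed.

Let measurable_density_itv (N : R) (b : bool) :
  measurable_fun [set` Interval (BLeft lambda0) (BSide b N)] phi_density.
Proof.
apply: measurable_funS measurable_phi_density => //.
by move=> x /=; rewrite !in_itv/= => /andP[lx _]; rewrite (le_trans b0_le_lambda0).
Qed.

Let density_itv_ge0 (N x : R) (b : bool) :
  [set` Interval (BLeft lambda0) (BSide b N)] x -> 0 <= phi_density x.
Proof.
rewrite /= in_itv/= => /andP[lx _]; apply: phi_density_ge0.
exact: le_trans (ltW lambda0_gt0) lx.
Qed.

Lemma layer_lower (N u : R) : lambda0 <= N -> 0 <= u ->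
  ((phi (Num.min u N))%:E <= (phi lambda0)%:E +
     \int[mu]_(x in `[lambda0, N]) (phi_density x * (x < u)%R%:R)%:E)%E.
Proof.
move=> lN u0.
have N0 : 0 <= N := le_trans (ltW lambda0_gt0) lN.
have min0 : 0 <= Num.min u N by rewrite le_min u0.
have mI : measurable_fun setT (fun x : R => (x < u)%R%:R : R).
  rewrite (_ : (fun x => _) = fun x => (- u < - x)%R%:R); last first.
    by apply/funext => x; rewrite ltrN2.
  by apply: measurable_ltr_nat; exact: oppr_measurable.
have mDI : measurable_fun `[lambda0, N] (fun x => (phi_density x * (x < u)%R%:R)%:E).
  apply/measurable_EFinP; apply: measurable_funM; first exact: measurable_density_itv.
  exact: measurable_funTS.
have DI0 x : `[lambda0, N]%classic x -> (0 <= (phi_density x * (x < u)%R%:R)%:E)%E.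
  by move=> /density_itv_ge0 ?; rewrite lee_fin mulr_ge0.
have [ul|lu] := leP u lambda0.
  apply: (@le_trans _ _ (phi lambda0)%:E).
    by rewrite lee_fin phi_incr// ge_min ul.
  by rewrite leeDl// integral_ge0.
have lP : lambda0 <= Num.min u N by rewrite le_min (ltW lu).
rewrite addeC -leeBlDr// -EFinB -phi_integral// ?b0_le_lambda0//.
(* The strict inequality [x < u] fails at the endpoint, which is dropped as a null set. *)
rewrite -[leLHS]integral_itv_bndo_bndc; last first.
  by apply/measurable_EFinP; exact: (@measurable_density_itv (Num.min u N) true).
apply: le_integral_support => //.
- by apply/measurable_EFinP; exact: measurable_density_itv.
- by move=> x xi; rewrite lee_fin; exact: (density_itv_ge0 xi).
- move=> x; rewrite /= in_itv/= lt_min => /andP[lx /andP[xu xN]]; right.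
  by rewrite in_itv/= lx (ltW xN) xu mulr1.
Qed.

(** The integral is at most [phi (sigma v)], and [phi_doubling] removes [sigma]. The constant does
    not depend on [N], as the limit in [N] requires. *)
Lemma layer_upper (sigma : R) : 0 < sigma -> exists2 C : R, 0 < C &
  forall N v, lambda0 <= N -> 0 <= v ->
    (\int[mu]_(x in `[lambda0, N]) (phi_density x * (x / sigma < v)%R%:R)%:E <=
      (C * phi v)%:E)%E.
Proof.
move=> sg0; have [|C C0 phiC] := @phi_doubling (Num.max 1 sigma).
  by rewrite le_max lexx.
exists C => // N v lN v0.
have phiv : phi (sigma * v) <= C * phi v.
  apply: le_trans (phiC _ v0); apply: phi_incr.
    by rewrite mulr_ge0// ltW.
  by rewrite ler_wpM2r// le_max lexx orbT.
have sv0 : 0 <= sigma * v by rewrite mulr_ge0// ltW.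
have xsE x : (x / sigma < v) = (x < sigma * v) by rewrite ltr_pdivrMr// mulrC.
have [sl|ls] := leP (sigma * v) lambda0.
  rewrite integral0_eq; first by rewrite lee_fin mulr_ge0 ?(ltW C0) ?(ltW (phi_gt0 v0)).
  move=> x; rewrite /= in_itv/= => /andP[lx _]; rewrite xsE ltNge (le_trans sl)//=.
  by rewrite mulr0.
apply: (@le_trans _ _ (phi (sigma * v) - phi lambda0)%:E); last first.
  by rewrite lee_fin; apply: le_trans phiv; rewrite gerBl ltW// phi_gt0// ltW.
rewrite -phi_integral ?(ltW ls) ?b0_le_lambda0//.
have mI : measurable_fun setT (fun x : R => (x / sigma < v)%R%:R : R).
  rewrite (_ : (fun x => _) = fun x => (- v < - (x / sigma))%R%:R); last first.
    by apply/funext => x; rewrite ltrN2.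
  apply: measurable_ltr_nat; apply: measurableT_comp; first exact: oppr_measurable.
  exact: measurable_funM.
apply: le_integral_support => //.
- apply/measurable_EFinP; apply: measurable_funM; first exact: measurable_density_itv.
  exact: measurable_funTS.
- by apply/measurable_EFinP; exact: measurable_density_itv.
- by move=> x /density_itv_ge0 ?; rewrite lee_fin mulr_ge0.
- by move=> x xi; rewrite lee_fin; exact: (density_itv_ge0 xi).
- move=> x xi; have dx := density_itv_ge0 xi; move: xi => /=.
  rewrite !in_itv/= => /andP[lx xN].
  rewrite xsE; have [xs|_] := ltP x (sigma * v); last by left; rewrite mulr0.
  by right; rewrite lx (ltW xs) mulr1.
Qed.

(** This is what the power [a^q] in the weight is for: one factor [a] pays for the level-set
    estimate and the other [q - 1] turn [x] into [s(x)]. *)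
Lemma weight_sfun x : 0 < x ->
  weight x * (afun x * x `^ (q - 1)) = sfun x `^ (q - 1) / x.
Proof.
move=> x0; have a0 := afun_gt0 x.
rewrite /Defs.sfun powRM ?invr_ge0 ?(ltW x0) ?(ltW a0)//.
have -> : (afun x)^-1 `^ (q - 1) = (afun x `^ (q - 1))^-1.
  apply: (mulIf (lt0r_neq0 (powR_gt0 (q - 1) a0))).
  rewrite mulVf; last by rewrite gt_eqF// powR_gt0.
  by rewrite -powRM ?invr_ge0 ?(ltW a0)// mulVf ?gt_eqF// powR1.
rewrite /Defs.weight -(@mulr_powRB1 _ (afun x) q) ?(ltW a0)//; field.
by rewrite !gt_eqF ?powR_gt0.
Qed.

(** The integrand is [c phi(x) s(x)^(q-1) / x] and vanishes beyond [lambda(k u)]. With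
    [Q = min(lambda(k u), N)], monotonicity of [phi] and [sfun_growth] bound it by
    [c phi(Q) s(Q)^(q-1) Q^(-p) x^(p-1)], where [p = (1 - omega0)(q - 1)]. The integral is then at
    most [c / p = theta / (q - 1)] times [phi(Q) s(Q)^(q-1)], where [s(Q) <= k u], and the
    definition of [M(k)] compares [phi(Q)] with [phi(min(u, N))]. *)
Lemma layer_middle (N u : R) : Mfun k \is a fin_num -> lambda0 <= N -> 0 <= u ->
  (\int[mu]_(x in `[lambda0, N])
     (phi_density x * (afun x * x `^ (q - 1)) * (sfun x / k < u)%R%:R)%:E <=
   (theta / (q - 1) * (k * u) `^ (q - 1) * expR (theta * fine (Mfun k)) *
     phi (Num.min u N))%:E)%E.
Proof.
move=> Mfin lN u0; have q1' : 0 < q - 1 by rewrite subr_gt0.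
set E := expR _.
have N0 : 0 <= N := le_trans (ltW lambda0_gt0) lN.
have min0 : 0 <= Num.min u N by rewrite le_min u0.
have rhs0 : 0 <= theta / (q - 1) * (k * u) `^ (q - 1) * E * phi (Num.min u N).
  rewrite mulr_ge0 ?(ltW (phi_gt0 min0))// mulr_ge0 ?expR_ge0//.
  by rewrite mulr_ge0 ?powR_ge0// divr_ge0// ltW.
have skE x : (sfun x / k < u) = (sfun x < k * u) by rewrite ltr_pdivrMr// mulrC.
have [ks|sk] := leP (k * u) s0.
  rewrite integral0_eq; first by rewrite lee_fin.
  move=> x; rewrite /= in_itv/= => /andP[lx _]; rewrite skE.
  by rewrite ltNge (le_trans ks) ?sfun_ge_s0//= mulr0.
have bu : b0 <= u by rewrite ler_pdivrMr// mulrC ltW.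
have [lL sL] := lambdafunP n_gt0 q_gt1 r0_gt0 r0_lt1 omega_ge0 omega_nd omega_cont
  omega0_lt1 (ltW sk).
set L := lambdafun (k * u) in lL sL.
(* Here [k >= 1] makes the oriented integral from [u] to [lambda(k u)] non-negative, and with it
   [M(k)]. *)
have uL : u <= L.
  have L0 : 0 < L := lt_le_trans lambda0_gt0 lL.
  apply: (@le_trans _ _ (k * u)); first by rewrite ler_peMl.
  by rewrite -sL sfun_le// ltW.
pose Q := Num.min L N.
have lQ : lambda0 <= Q by rewrite le_min lL.
have Q0 : 0 < Q := lt_le_trans lambda0_gt0 lQ.
have phiQ : phi Q <= E * phi (Num.min u N).
  have oE : oint u L weight <= fine (Mfun k) by exact: oint_le_Mfun.
  have o0 : 0 <= oint u L weight by exact: oint_weight_ge0.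
  have M0 : 0 <= fine (Mfun k) := le_trans o0 oE.
  have [uN|Nu] := leP u N.
    apply: (@le_trans _ _ (phi L)).
      by apply: phi_incr; [exact: ltW|rewrite ge_min lexx].
    rewrite (phi_ratio bu uL) mulrC ler_wpM2r ?(ltW (phi_gt0 u0))//.
    rewrite ler_expR /c -mulrA ler_wpM2l ?(ltW theta_gt0)//.
    apply: le_trans oE; rewrite ler_piMl// gerBl.
    exact/omega_ge0/ltW.
  (* When [u > N] both truncated values are at most [phi N], and what is needed is
     [exp(theta M(k)) >= 1]. *)
  apply: (@le_trans _ _ (phi N)).
    by apply: phi_incr; [exact: ltW|rewrite ge_min lexx orbT].
  by rewrite ler_peMl ?(ltW (phi_gt0 N0))// -expR0 ler_expR mulr_ge0// ltW.
have sQ : sfun Q <= k * u.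
  rewrite -sL /Q; case: (leP L N) => // NL.
  exact: (ltW (sfun_lt n_gt0 q_gt1 r0_gt0 r0_lt1 omega_ge0 omega_nd omega0_lt1 lN NL)).
have sQ0 : 0 < sfun Q by exact: sfun_gt0.
pose p := (1 - omega0) * (q - 1).
have p0 : 0 < p by rewrite mulr_gt0// subr_gt0.
pose K := c * phi Q * sfun Q `^ (q - 1) * (Q `^ p)^-1 / p.
have K0 : 0 <= K.
  rewrite divr_ge0 ?(ltW p0)// mulr_ge0 ?invr_ge0 ?powR_ge0//.
  by rewrite mulr_ge0 ?powR_ge0// mulr_ge0 ?(ltW c_gt0)// ltW// phi_gt0// ltW.
apply: (@le_trans _ _
    (\int[mu]_(x in `[lambda0, Q]) (K%:E * (p * x `^ (p - 1))%:E))%E); last first.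
  have mp : measurable_fun `[lambda0, Q] (fun x : R => (p * x `^ (p - 1))%:E).
    apply/measurable_EFinP; apply: measurable_funM => //.
    by apply: measurable_funTS; exact: measurable_powR.
  rewrite ge0_integralZl//; last first.
    by move=> x _; rewrite lee_fin mulr_ge0 ?powR_ge0// ltW.
  rewrite integral_powR// -EFinM lee_fin.
  apply: (@le_trans _ _ (K * Q `^ p)).
    by rewrite ler_wpM2l// gerBl powR_ge0.
  have -> : K * Q `^ p = theta / (q - 1) * sfun Q `^ (q - 1) * phi Q.
    rewrite /K /c /p; field.
    by rewrite !gt_eqF ?powR_gt0// ?subr_gt0.
  rewrite -!mulrA; apply: ler_pM; rewrite ?(ltW theta_gt0)//.
    rewrite !mulr_ge0 ?invr_ge0 ?powR_ge0 ?(ltW q1')//.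
    by rewrite ltW// phi_gt0// ltW.
  rewrite ler_wpM2l ?invr_ge0 ?(ltW q1')//; apply: ler_pM => //.
  - exact: powR_ge0.
  - by rewrite ltW// phi_gt0// ltW.
  - by apply: ge0_ler_powR; rewrite ?nnegrE ?(ltW q1') ?(ltW sQ0)// mulr_ge0// ltW.
have mden : measurable_fun `[lambda0, N]
    (fun x => (phi_density x * (afun x * x `^ (q - 1)) * (sfun x / k < u)%R%:R)%:E).
  apply/measurable_EFinP.
  have ma : measurable_fun setT afun.
    apply: continuous_measurable_fun.
    exact: continuous_afun.
  apply: measurable_funM.
    apply: measurable_funM; first exact: measurable_density_itv.
    apply: measurable_funM; first exact: measurable_funTS.
    by apply: measurable_funTS; exact: measurable_powR.
  apply: measurable_funTS.
  rewrite (_ : (fun x => _) = fun x => (- u < - (sfun x / k))%R%:R); last first.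
    by apply/funext => x; rewrite ltrN2.
  apply: measurable_ltr_nat; apply: measurableT_comp; first exact: oppr_measurable.
  apply: measurable_funM => //; apply: measurable_funM => //.
  apply: continuous_measurable_fun => x; apply: cvgV; first by rewrite gt_eqF.
  exact: continuous_afun.
apply: le_integral_support => //.
- rewrite (_ : (fun x => _) = (fun x => (K * (p * x `^ (p - 1)))%:E)); last first.
    by apply/funext => x; rewrite EFinM.
  apply/measurable_EFinP; apply: measurable_funM => //; apply: measurable_funM => //.
  by apply: measurable_funTS; exact: measurable_powR.
- move=> x /density_itv_ge0 ?; rewrite lee_fin mulr_ge0// mulr_ge0//.
  by rewrite mulr_ge0 ?powR_ge0// ltW.
- by move=> x _; rewrite -EFinM lee_fin mulr_ge0// mulr_ge0 ?powR_ge0// ltW.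
move=> x; rewrite /= !in_itv/= => /andP[lx xN]; rewrite skE.
have [xs|_] := ltP (sfun x) (k * u); last by left; rewrite mulr0.
right; rewrite lx mulr1 /=.
have x0 : 0 < x := lt_le_trans lambda0_gt0 lx.
have xL : x < L.
  rewrite ltNge; apply/negP; rewrite le_eqVlt => /predU1P[Lx|Lx].
    by move: xs; rewrite -Lx sL ltxx.
  have := sfun_lt n_gt0 q_gt1 r0_gt0 r0_lt1 omega_ge0 omega_nd omega0_lt1 lL Lx.
  by rewrite sL => /(lt_trans xs); rewrite ltxx.
have xQ : x <= Q by rewrite le_min xN ltW.
split=> //; rewrite -EFinM lee_fin.
have -> : phi_density x * (afun x * x `^ (q - 1)) =
    c * phi x * (sfun x `^ (q - 1) / x).
  by rewrite -weight_sfun// /phi_density -/c; ring.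
have phix : phi x <= phi Q by apply: phi_incr => //; exact: ltW.
have sx : sfun x `^ (q - 1) <= sfun Q `^ (q - 1) * (x / Q) `^ p.
  rewrite /p powRrM -powRM ?(ltW sQ0) ?powR_ge0//.
  have sx0 : 0 <= sfun x by rewrite ltW// sfun_gt0.
  have sQx0 : 0 <= sfun Q * (x / Q) `^ (1 - omega0).
    by apply: mulr_ge0; [exact: ltW|exact: powR_ge0].
  apply: ge0_ler_powR; rewrite ?nnegrE ?(ltW q1')//.
  exact: sfun_growth.
apply: (@le_trans _ _ (c * phi Q * (sfun Q `^ (q - 1) * (x / Q) `^ p / x))).
  apply: ler_pM.
  - by rewrite mulr_ge0 ?(ltW c_gt0)// ltW// phi_gt0// ltW.
  - by rewrite divr_ge0 ?powR_ge0// ltW.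
  - by rewrite ler_wpM2l// ltW.
  - by rewrite ler_wpM2r// invr_ge0 ltW.
rewrite le_eqVlt; apply/orP; left; apply/eqP.
have -> : (x / Q) `^ p = x `^ p / Q `^ p.
  have QQ : Q `^ p * Q^-1 `^ p = 1.
    by rewrite -powRM ?invr_ge0 ?(ltW Q0)// divff ?gt_eqF// powR1.
  rewrite powRM ?invr_ge0 ?(ltW x0) ?(ltW Q0)//; congr (_ * _).
  apply: (mulfI (lt0r_neq0 (powR_gt0 p Q0))); rewrite QQ divff// gt_eqF//.
  exact: powR_gt0.
rewrite -(@mulr_powRB1 _ x p) ?(ltW x0)// /K; field.
by rewrite !gt_eqF ?powR_gt0.
Qed.

End phi.

(** * Integration over the levels and absorption *)

Lemma measurable_lt_nat d (T : measurableType d) (R : realType) (D : set T)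
    (h : T -> R) (c : R) : measurable D ->
  measurable_fun D h -> measurable_fun D (fun x => (h x < c)%R%:R : R).
Proof.
move=> mD mh; apply: (@eq_measurable_fun _ _ _ _ _
    (fun x => (- c < - (h \_ D) x)%R%:R : R)).
  by move=> x Dx; rewrite /= patchE Dx ltrN2.
apply: measurable_funTS; apply: measurable_ltr_nat.
by apply: measurableT_comp; [exact: oppr_measurable|apply/(measurable_restrictT h)].
Qed.

Section layer_tonelli.
Context d (T : measurableType d) (R : realType)
  (m : {sigma_finite_measure set T -> \bar R}).
Variables (F h : T -> R) (G t : R -> R) (D : set R).
Hypotheses (mD : measurable D) (mF : measurable_fun setT F) (mh : measurable_fun setT h)
  (mG : measurable_fun D G) (mt : measurable_fun D t).
Hypotheses (F0 : forall x, 0 <= F x) (G0 : forall y, D y -> 0 <= G y).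

Local Notation mu := (@lebesgue_measure R).

(** [G] and [t] are extended by zero off [D] to be measurable on the full product, and the
    comparison is the sign of a difference so that measurability of an indicator with constant
    threshold suffices. *)
Let f (z : T * measurableTypeR R) : \bar R :=
  (F z.1 * (G \_ D) z.2 * (0 < h z.1 - (t \_ D) z.2)%R%:R)%:E.

Let mf : measurable_fun setT f.
Proof.
have mGD : measurable_fun setT (G \_ D) by apply/(measurable_restrictT G).
have mtD : measurable_fun setT (t \_ D) by apply/(measurable_restrictT t).
apply/measurable_EFinP; apply: measurable_funM.
  apply: measurable_funM; first exact: (measurableT_comp mF measurable_fst).
  exact: (measurableT_comp mGD measurable_snd).
apply: measurable_ltr_nat; apply: measurable_funB.
  exact: (measurableT_comp mh measurable_fst).
exact: (measurableT_comp mtD measurable_snd).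
Qed.

Let GD0 y : 0 <= (G \_ D) y.
Proof. by rewrite patchE; case: ifPn => // /set_mem; exact: G0. Qed.

Let f0 z : (0 <= f z)%E.
Proof. by rewrite lee_fin mulr_ge0// mulr_ge0. Qed.

Let fE1 x : (\int[mu]_y f (x, y) =
  (F x)%:E * \int[mu]_(y in D) (G y * (t y < h x)%R%:R)%:E)%E.
Proof.
rewrite -ge0_integralZl//; last 3 first.
- apply/measurable_EFinP; apply: measurable_funM => //.
  exact: measurable_lt_nat.
- by move=> y Dy; rewrite lee_fin mulr_ge0// G0.
- by rewrite lee_fin.
rewrite [RHS]integral_mkcond; apply: eq_integral => y _.
rewrite /f /= !patchE; case: ifPn => Dy; last by rewrite mulr0 mul0r.
by rewrite subr_gt0 -EFinM mulrA.
Qed.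

Let fE2 y : (\int[m]_x f (x, y) =
  ((fun y => (G y)%:E * \int[m]_x (F x * (t y < h x)%R%:R)%:E) \_ D) y)%E.
Proof.
rewrite patchE; case: ifPn => Dy; last first.
  apply: integral0_eq => x _; rewrite /f /= patchE (negbTE Dy).
  by rewrite mulr0 mul0r.
rewrite -ge0_integralZl//; last 3 first.
- by apply/measurable_EFinP; apply: measurable_funM => //; exact: measurable_ltr_nat.
- by move=> x _; rewrite lee_fin mulr_ge0.
- by rewrite lee_fin G0//; exact: set_mem.
apply: eq_integral => x _; rewrite /f /= !patchE Dy.
by rewrite subr_gt0 -EFinM mulrCA mulrA.
Qed.

Lemma layer_tonelli :
  (\int[m]_x ((F x)%:E * \int[mu]_(y in D) (G y * (t y < h x)%R%:R)%:E) =
   \int[mu]_(y in D) ((G y)%:E * \int[m]_x (F x * (t y < h x)%R%:R)%:E))%E.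
Proof.
rewrite [RHS]integral_mkcond.
rewrite (eq_integral (fun x => \int[mu]_y f (x, y))%E); last first.
  by move=> x _; rewrite fE1.
rewrite [RHS](eq_integral (fun y => \int[m]_x f (x, y))%E); last first.
  by move=> y _; rewrite fE2.
exact: (@fubini_tonelli _ _ _ _ _ m mu f).
Qed.

Lemma measurable_layer1 : measurable_fun setT
  (fun x => (F x)%:E * \int[mu]_(y in D) (G y * (t y < h x)%R%:R)%:E)%E.
Proof.
rewrite (_ : (fun _ => _) = fun x => \int[mu]_y f (x, y))%E; last first.
  by apply/funext => x; rewrite fE1.
exact: (@measurable_fun_fubini_tonelli_F _ _ _ _ _ mu f).
Qed.

Lemma measurable_layer2 : measurable_fun D
  (fun y => (G y)%:E * \int[m]_x (F x * (t y < h x)%R%:R)%:E)%E.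
Proof.
apply/(measurable_restrictT _ mD).
rewrite (_ : _ \_ _ = fun y => \int[m]_x f (x, y))%E; last first.
  by apply/funext => y; rewrite fE2.
exact: (@measurable_fun_fubini_tonelli_G _ _ _ _ _ m f).
Qed.

End layer_tonelli.

Section absorption.
Context (R : realType) (n : nat) (r0 q c0 c1 theta : R) (omega phi : R -> R).
Hypotheses (n_gt0 : (0 < n)%N) (r0_gt0 : 0 < r0) (r0_lt1 : r0 < 1).
Hypothesis omega_ge0 : forall r, 0 <= r -> 0 <= omega r.
Hypothesis omega_nd : forall x y, 0 <= x -> x <= y -> omega x <= omega y.
Hypothesis omega_cont : {within `[0, +oo[, continuous omega}.
Hypotheses (omega0_lt1 : omega0 r0 omega < 1) (q_gt1 : 1 < q).
Hypotheses (c0_ge : 1 <= 4 * c0) (c1_gt0 : 0 < c1) (theta_gt0 : 0 < theta).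
Hypothesis Mfin : Mfun n q r0 omega (4 * c0) \is a fin_num.
Hypothesis theta_eq : 4 ^+ n * (4 * c0) `^ q * theta *
  expR (theta * fine (Mfun n q r0 omega (4 * c0))) / (q - 1) = 2^-1.
Hypothesis phi_gt0 : forall s, 0 <= s -> 0 < phi s.
Hypothesis phi_incr : forall s t, 0 <= s -> s <= t -> phi s <= phi t.
Hypothesis phi_eq : forall s, s0 n q r0 omega / (4 * c0) <= s ->
  phi s = expR (theta * (1 - omega0 r0 omega)
    * oint (s0 n q r0 omega / (4 * c0)) s (weight n q r0 omega)).

Context (l : R) (f g : Rn R n -> R).
Local Notation mu := (lebesgue_Rn R n).
Hypotheses (l_ge1 : 1 <= l) (mf : measurable_fun setT f) (mg : measurable_fun setT g).
Hypotheses (f_ge0 : forall x, 0 <= f x) (g_ge0 : forall x, 0 <= g x).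
Hypotheses (ifq : mu.-integrable setT (fun x => (f x `^ q)%:E))
  (igq : mu.-integrable setT (fun x => (g x `^ q)%:E)).
Hypothesis fq1 : (\int[mu]_x (f x `^ q)%:E <= 1)%E.
Hypothesis reverse_hoelder : forall (r : R) (x0 : Rn R n), 0 < r <= r0 ->
  mean (cube r x0) (fun x => f x `^ q)
  <= c0 * mean (cube (l * r) x0) f `^ (q + omega r)
     + c1 * mean (cube (l * r) x0) (fun x => g x `^ q).

Local Notation lambda0 := (Defs.lambda0 n q r0).
Local Notation afun := (Defs.afun n q r0 omega).
Local Notation sfun := (Defs.sfun n q r0 omega).
Local Notation density := (phi_density n q r0 theta omega phi).
Local Notation sigma := ((4 * c1) `^ q^-1).

Let c0_gt0 : 0 < c0. Proof. by rewrite -(pmulr_rgt0 _ (ltr0n R 4)) (lt_le_trans ltr01). Qed.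
Let k_gt0 : 0 < 4 * c0 := lt_le_trans ltr01 c0_ge.
Let lambda0_gt1 := lambda0_gt1 n_gt0 q_gt1 r0_gt0 r0_lt1.
Let lambda0_gt0 : 0 < lambda0 := lt_trans ltr01 lambda0_gt1.
Let q_gt0 : 0 < q := lt_trans ltr01 q_gt1.
Let sigma_gt0 : 0 < sigma. Proof. by rewrite powR_gt0 ?mulr_gt0. Qed.
Let b0_le := b0_le_lambda0 n_gt0 q_gt1 r0_gt0 r0_lt1 omega_ge0 k_gt0 c0_ge.

(** The bound for the layer integral of [g] is a hypothesis so that [Cg] is fixed before [N], [l],
    [f] and [g]. *)
Lemma truncated_estimate (Cg N : R) : 0 < Cg -> lambda0 <= N ->
  (forall v, 0 <= v ->
    (\int[lebesgue_measure]_(x in `[lambda0, N])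
        (density x * (x / sigma < v)%R%:R)%:E <= (Cg * phi v)%:E)%E) ->
  (\int[mu]_x (f x `^ q * phi (Num.min (f x) N))%:E <=
    (phi lambda0)%:E
    + (4^-1)%:E * \int[mu]_x (f x `^ q * phi (Num.min (f x) N))%:E
    + (3 ^+ n * (2 * c1) * Cg)%:E * \int[mu]_x (g x `^ q * phi (g x))%:E)%E.
Proof.
move=> Cg0 lN phig.
have N0 : 0 <= N := le_trans (ltW lambda0_gt0) lN.
pose D : set R := `[lambda0, N]%classic.
have mD : measurable D by exact: measurable_itv.
have Dl x : D x -> lambda0 <= x by rewrite /D/= in_itv/= => /andP[].
have D0 x : D x -> 0 < x by move=> /Dl; exact: lt_le_trans.
have dD0 x : D x -> 0 <= density x.
  move=> /D0 /ltW x0.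
  exact: (phi_density_ge0 n q omega0_lt1 theta_gt0 phi_gt0 x0).
have md : measurable_fun D density.
  have sub : D `<=` `[s0 n q r0 omega / (4 * c0), +oo[%classic.
    by move=> x /Dl lx; rewrite /= in_itv/= andbT (le_trans b0_le).
  apply: measurable_funS sub _ => //.
  exact: measurable_phi_density.
have mfq : measurable_fun setT (fun x => f x `^ q).
  by apply/measurable_EFinP; exact: measurable_int ifq.
have mgq : measurable_fun setT (fun x => g x `^ q).
  by apply/measurable_EFinP; exact: measurable_int igq.
have fq0 x : 0 <= f x `^ q by exact: powR_ge0.
have gq0 x : 0 <= g x `^ q by exact: powR_ge0.
have ma : measurable_fun D afun.
  apply: measurable_funTS; apply: continuous_measurable_fun.
  exact: continuous_afun.
have mpow : measurable_fun D (fun y : R => y `^ (q - 1)).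
  by apply: measurable_funTS; exact: measurable_powR.
have a_gt0 y : 0 < afun y.
  exact: lt_le_trans ltr01 (afun_ge1 n_gt0 q_gt1 r0_gt0 r0_lt1 y omega_ge0).
have msk : measurable_fun D (fun y => sfun y / (4 * c0)).
  apply: measurable_funM => //; apply: measurable_funM => //.
  apply: measurable_funTS; apply: continuous_measurable_fun => y.
  by apply: cvgV; [rewrite gt_eqF|exact: continuous_afun].
have msg : measurable_fun D (fun y : R => y / sigma) by exact: measurable_funM.
have mid : measurable_fun D (fun y : R => y) by exact: measurable_id.
pose G2 y := density y * (afun y * y `^ (q - 1)).
have mG2 : measurable_fun D G2.
  by apply: measurable_funM => //; exact: measurable_funM.
have G20 y : D y -> 0 <= G2 y.
  move=> Dy; rewrite /G2 mulr_ge0 ?dD0// mulr_ge0 ?powR_ge0//.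
  exact: ltW.
have min0 x : 0 <= Num.min (f x) N by rewrite le_min f_ge0.
have phimin0 x : 0 <= phi (Num.min (f x) N) by rewrite ltW// phi_gt0.
have mphimin : measurable_fun setT (fun x => phi (Num.min (f x) N)).
  by apply: measurable_phi_comp => //; exact: measurable_minr.
have mphig : measurable_fun setT (fun x => phi (g x)).
  exact: measurable_phi_comp.
have mXf : measurable_fun setT (fun x => (f x `^ q * phi (Num.min (f x) N))%:E).
  by apply/measurable_EFinP; exact: measurable_funM.
have mYf : measurable_fun setT (fun x => (g x `^ q * phi (g x))%:E).
  by apply/measurable_EFinP; exact: measurable_funM.
set X := (\int[mu]_x (f x `^ q * phi (Num.min (f x) N))%:E)%E.
set Y := (\int[mu]_x (g x `^ q * phi (g x))%:E)%E.
have phil0 : 0 < phi lambda0 by rewrite phi_gt0// ltW.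
have I0 (G t : R -> R) u : (forall y, D y -> 0 <= G y) ->
    (0 <= \int[lebesgue_measure]_(y in D) (G y * (t y < u)%R%:R)%:E)%E.
  by move=> G0; apply: integral_ge0 => y Dy; rewrite lee_fin mulr_ge0// G0.
(* With the level integral inside, the layer lemmas apply at each [x]; after [layer_tonelli] it is
   outside and [level_set_integral] applies at each level. *)
pose S1 := (\int[mu]_x ((f x `^ q)%:E *
  \int[lebesgue_measure]_(y in D) (density y * (y < f x)%R%:R)%:E))%E.
pose S2 := (\int[mu]_x ((f x)%:E *
  \int[lebesgue_measure]_(y in D) (G2 y * (sfun y / (4 * c0) < f x)%R%:R)%:E))%E.
pose S3 := (\int[mu]_x ((g x `^ q)%:E *
  \int[lebesgue_measure]_(y in D) (density y * (y / sigma < g x)%R%:R)%:E))%E.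
have XS1 : (X <= (phi lambda0)%:E + S1)%E.
  apply: (@le_trans _ _ (\int[mu]_x ((phi lambda0)%:E * (f x `^ q)%:E +
      (f x `^ q)%:E * \int[lebesgue_measure]_(y in D) (density y * (y < f x)%R%:R)%:E))%E).
    apply: ge0_le_integral => //.
    - by move=> x _; rewrite lee_fin mulr_ge0.
    - apply: emeasurable_funD; first by apply: measurable_funeM; exact/measurable_EFinP.
      exact: measurable_layer1.
    - move=> x _; rewrite EFinM [((phi lambda0)%:E * _)%E]muleC.
      rewrite -ge0_muleDr ?lee_fin ?(ltW phil0) ?I0//.
      apply: lee_wpmul2l; first by rewrite lee_fin.
      exact: (layer_lower n_gt0 q_gt1 r0_gt0 r0_lt1 omega_ge0 omega_cont omega0_lt1 k_gt0
        theta_gt0 phi_gt0 phi_incr phi_eq c0_ge lN (f_ge0 x)).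
  rewrite ge0_integralD//; last 4 first.
  - by move=> x _; rewrite -EFinM lee_fin mulr_ge0// ltW.
  - by apply: measurable_funeM; exact/measurable_EFinP.
  - by move=> x _; rewrite mule_ge0 ?lee_fin ?I0.
  - exact: measurable_layer1.
  (* The normalisation of [f] turns the integral of [phi(lambda0) f^q] into [phi(lambda0)]. *)
  rewrite leeD2r// ge0_integralZl//; last 3 first.
  - exact/measurable_EFinP.
  - by move=> x _; rewrite lee_fin.
  - by rewrite lee_fin ltW.
  by rewrite -[leRHS]mule1 lee_wpmul2l// lee_fin ltW.
have S1le : (S1 <= (3 ^+ n * (2 * c0))%:E * S2 + (3 ^+ n * (2 * c1))%:E * S3)%E.
  have n3 : 0 <= 3 ^+ n :> R by exact: exprn_ge0.
  have mf1 y : measurable_fun setT (fun x => (f x * (sfun y / (4 * c0) < f x)%R%:R)%:E).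
    by apply/measurable_EFinP; apply: measurable_funM => //; exact: measurable_ltr_nat.
  have mg1 y : measurable_fun setT (fun x => (g x `^ q * (y / sigma < g x)%R%:R)%:E).
    by apply/measurable_EFinP; apply: measurable_funM => //; exact: measurable_ltr_nat.
  have f10 y x : (0 <= (f x * (sfun y / (4 * c0) < f x)%R%:R)%:E)%E.
    by rewrite lee_fin mulr_ge0.
  have g10 y x : (0 <= (g x `^ q * (y / sigma < g x)%R%:R)%:E)%E.
    by rewrite lee_fin mulr_ge0.
  have A2 : 0 <= 3 ^+ n * (2 * c0) by rewrite mulr_ge0// mulr_ge0// ltW.
  have A3 : 0 <= 3 ^+ n * (2 * c1) by rewrite mulr_ge0// mulr_ge0// ltW.
  rewrite /S1 /S2 /S3 !layer_tonelli//.
  rewrite -!ge0_integralZl//; last 4 first.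
  - exact: measurable_layer2.
  - by move=> y Dy; rewrite mule_ge0 ?lee_fin ?dD0// integral_ge0.
  - exact: measurable_layer2.
  - by move=> y Dy; rewrite mule_ge0 ?lee_fin ?G20// integral_ge0.
  rewrite -ge0_integralD//; last 4 first.
  - by move=> y Dy; rewrite mule_ge0 ?lee_fin// mule_ge0 ?lee_fin ?G20// integral_ge0.
  - by apply: measurable_funeM; exact: measurable_layer2.
  - by move=> y Dy; rewrite mule_ge0 ?lee_fin// mule_ge0 ?lee_fin ?dD0// integral_ge0.
  - by apply: measurable_funeM; exact: measurable_layer2.
  apply: ge0_le_integral => //.
  - move=> y Dy; rewrite mule_ge0 ?lee_fin ?dD0// integral_ge0// => x _.
    by rewrite lee_fin mulr_ge0.
  - exact: measurable_layer2.
  - by apply: emeasurable_funD; apply: measurable_funeM; exact: measurable_layer2.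
  - move=> y Dy; have ay : 0 <= afun y * y `^ (q - 1).
      by rewrite mulr_ge0 ?powR_ge0// ltW.
    apply: (@le_trans _ _ ((density y)%:E * ((3 ^+ n)%:E *
        \int[mu]_x (upper_part q r0 c0 c1 omega f g y x)%:E))%E).
      apply: lee_wpmul2l; first by rewrite lee_fin dD0.
      exact: (level_set_integral n_gt0 q_gt1 r0_gt0 r0_lt1 omega_ge0 omega_nd c0_gt0
        c1_gt0 l_ge1 mf mg f_ge0 g_ge0 ifq igq fq1 reverse_hoelder (Dl _ Dy)).
    have -> : (\int[mu]_x (upper_part q r0 c0 c1 omega f g y x)%:E =
        (2 * c0 * (afun y * y `^ (q - 1)))%:E *
          \int[mu]_x (f x * (sfun y / (4 * c0) < f x)%R%:R)%:E +
        (2 * c1)%:E * \int[mu]_x (g x `^ q * (y / sigma < g x)%R%:R)%:E)%E.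
      rewrite -!ge0_integralZl//; last 2 first.
      - by rewrite lee_fin mulr_ge0// ltW.
      - by rewrite lee_fin mulr_ge0// mulr_ge0// ltW.
      rewrite -ge0_integralD//; last 4 first.
      - by move=> x _; rewrite mule_ge0// lee_fin mulr_ge0// mulr_ge0// ltW.
      - exact: measurable_funeM.
      - by move=> x _; rewrite mule_ge0// lee_fin mulr_ge0// ltW.
      - exact: measurable_funeM.
    have i1 : (0 <= \int[mu]_x (f x * (sfun y / (4 * c0) < f x)%R%:R)%:E)%E.
      exact: integral_ge0.
    have i2 : (0 <= \int[mu]_x (g x `^ q * (y / sigma < g x)%R%:R)%:E)%E.
      exact: integral_ge0.
    rewrite muleA -EFinM ge0_muleDr; last 2 first.
    + by rewrite mule_ge0// lee_fin mulr_ge0// mulr_ge0// ltW.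
    + by rewrite mule_ge0// lee_fin mulr_ge0// ltW.
    rewrite !muleA -!EFinM le_eqVlt; apply/orP; left; apply/eqP.
    by congr (_%:E * _ + _%:E * _)%E; rewrite /G2; ring.
have S2le : ((3 ^+ n * (2 * c0))%:E * S2 <= (4^-1)%:E * X)%E.
  (* The constant of [layer_middle], after [f (4 c0 f)^(q-1) = (4 c0)^(q-1) f^q]. *)
  pose B := theta / (q - 1) * (4 * c0) `^ (q - 1) *
    expR (theta * fine (Mfun n q r0 omega (4 * c0))).
  have q1' : 0 < q - 1 by rewrite subr_gt0.
  have B0 : 0 <= B.
    by rewrite mulr_ge0 ?expR_ge0// mulr_ge0 ?powR_ge0// divr_ge0// ltW.
  have S2B : (S2 <= B%:E * X)%E.
    rewrite -ge0_integralZl//; last by move=> x _; rewrite lee_fin mulr_ge0.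
    apply: ge0_le_integral => //.
    - by move=> x _; rewrite mule_ge0 ?lee_fin ?I0.
    - exact: measurable_layer1.
    - exact: measurable_funeM.
    - move=> x _.
      have := layer_middle n_gt0 q_gt1 r0_gt0 r0_lt1 omega_ge0 omega_nd omega_cont omega0_lt1
        k_gt0 theta_gt0 phi_gt0 phi_incr phi_eq c0_ge Mfin lN (f_ge0 x).
      have fx0 : (0 <= (f x)%:E)%E by rewrite lee_fin.
      move=> /(lee_wpmul2l fx0) /le_trans; apply.
      rewrite -!EFinM lee_fin le_eqVlt; apply/orP; left; apply/eqP.
      rewrite -(@mulr_powRB1 _ (f x) q)// powRM ?(ltW k_gt0)// /B; ring.
  apply: (@le_trans _ _ ((3 ^+ n * (2 * c0))%:E * (B%:E * X))%E).
    by apply: lee_wpmul2l => //; rewrite lee_fin mulr_ge0 ?exprn_ge0// mulr_ge0// ltW.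
  rewrite muleA -EFinM; apply: lee_wpmul2r.
    by apply: integral_ge0 => x _; rewrite lee_fin mulr_ge0.
  rewrite lee_fin.
  (* The coefficient of [X] is [(3/4)^n / 4]. *)
  have BE : 4 ^+ n * (4 * c0 * B) = 2^-1.
    rewrite -theta_eq /B -(@mulr_powRB1 _ (4 * c0) q) ?(ltW k_gt0)//; field.
    by rewrite gt_eqF.
  have n34 : 3 ^+ n <= 4 ^+ n :> R.
    by apply: lerXn2r; rewrite ?nnegrE// ler_nat.
  have cB0 : 0 <= 4 * c0 * B by rewrite mulr_ge0// ltW.
  have zle := ler_wpM2r cB0 n34; rewrite BE in zle.
  rewrite (_ : _ * _ * B = 3 ^+ n * (4 * c0 * B) / 2); last by field.
  lra.
have S3le : ((3 ^+ n * (2 * c1))%:E * S3 <= (3 ^+ n * (2 * c1) * Cg)%:E * Y)%E.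
  rewrite [(_ * _ * Cg)%:E]EFinM -muleA; apply: lee_wpmul2l.
    by rewrite lee_fin mulr_ge0 ?exprn_ge0// mulr_ge0// ltW.
  rewrite -ge0_integralZl//; last 2 first.
  - by move=> x _; rewrite lee_fin mulr_ge0// ltW// phi_gt0.
  - by rewrite lee_fin ltW.
  apply: ge0_le_integral => //.
  - by move=> x _; rewrite mule_ge0 ?lee_fin ?I0.
  - exact: measurable_layer1.
  - exact: measurable_funeM.
  - move=> x _; have gx0 : (0 <= (g x `^ q)%:E)%E by rewrite lee_fin.
    move: (phig _ (g_ge0 x)) => /(lee_wpmul2l gx0) /le_trans; apply.
    by rewrite -!EFinM mulrCA.
apply: (le_trans XS1); rewrite -addeA; apply: leeD2l.
by apply: (le_trans S1le); exact: leeD.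
Qed.

(** The truncated integral is at most [phi(N)], so a quarter of it can be subtracted. This gives the
    factor [4/3], rounded up to 4 in front of [phi(lambda0)] and to 2 in the term of [g]. *)
Lemma truncated_bound (Cg N : R) : 0 < Cg -> lambda0 <= N ->
  (forall v, 0 <= v ->
    (\int[lebesgue_measure]_(x in `[lambda0, N])
        (density x * (x / sigma < v)%R%:R)%:E <= (Cg * phi v)%:E)%E) ->
  (\int[mu]_x (f x `^ q * phi (Num.min (f x) N))%:E <=
    (4 * phi lambda0)%:E
    + (2 * (3 ^+ n * (2 * c1) * Cg))%:E * \int[mu]_x (g x `^ q * phi (g x))%:E)%E.
Proof.
move=> Cg0 lN phig; have := truncated_estimate Cg0 lN phig.
have N0 : 0 <= N := le_trans (ltW lambda0_gt0) lN.
have phil0 : 0 < phi lambda0 by rewrite phi_gt0// ltW.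
have phiN0 : 0 < phi N by exact: phi_gt0.
have min0 x : 0 <= Num.min (f x) N by rewrite le_min f_ge0.
have phimin0 x : 0 <= phi (Num.min (f x) N) by rewrite ltW// phi_gt0.
set A := 3 ^+ n * (2 * c1) * Cg.
have A0 : 0 < A by rewrite !mulr_gt0// exprn_gt0.
have : (\int[mu]_x (f x `^ q * phi (Num.min (f x) N))%:E <= (phi N)%:E)%E.
  apply: (@le_trans _ _ (\int[mu]_x ((phi N)%:E * (f x `^ q)%:E))%E).
    apply: ge0_le_integral => //.
    - by move=> x _; rewrite lee_fin mulr_ge0 ?powR_ge0.
    - apply/measurable_EFinP; apply: measurable_funM.
        by apply/measurable_EFinP; exact: measurable_int ifq.
      by apply: measurable_phi_comp => //; exact: measurable_minr.
    - by apply: measurable_funeM; exact: measurable_int ifq.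
    - move=> x _; rewrite -EFinM lee_fin mulrC ler_wpM2r ?powR_ge0//.
      by apply: phi_incr => //; rewrite ge_min lexx orbT.
  rewrite ge0_integralZl//; last 3 first.
  - exact: measurable_int ifq.
  - by move=> x _; rewrite lee_fin powR_ge0.
  - by rewrite lee_fin ltW.
  by rewrite -[leRHS]mule1 lee_wpmul2l// lee_fin ltW.
have : (0 <= \int[mu]_x (f x `^ q * phi (Num.min (f x) N))%:E)%E.
  by apply: integral_ge0 => x _; rewrite lee_fin mulr_ge0 ?powR_ge0.
have : (0 <= \int[mu]_x (g x `^ q * phi (g x))%:E)%E.
  by apply: integral_ge0 => x _; rewrite lee_fin mulr_ge0 ?powR_ge0// ltW// phi_gt0.
move: (\int[mu]_x (f x `^ q * phi (Num.min (f x) N))%:E)%E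
  (\int[mu]_x (g x `^ q * phi (g x))%:E)%E => [X| |] [Y| |]//=.
  rewrite -!EFinM -!EFinD !lee_fin => Y0 X0 _ XY.
  have p4 : 0 < phi lambda0 := phil0.
  have AY : 0 <= A * Y by rewrite mulr_ge0// ltW.
  rewrite -mulrA; lra.
(* If the integral of [g^q phi(g)] is infinite, so is the right-hand side. *)
move=> _ _ _ _; rewrite gt0_muley ?lte_fin ?mulr_gt0//.
by rewrite addey// leey.
Qed.

Lemma absorbed_estimate (Cg : R) : 0 < Cg ->
  (forall N v, lambda0 <= N -> 0 <= v ->
    (\int[lebesgue_measure]_(x in `[lambda0, N])
        (density x * (x / sigma < v)%R%:R)%:E <= (Cg * phi v)%:E)%E) ->
  (\int[mu]_x (f x `^ q * phi (f x))%:E <=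
    (4 * phi lambda0)%:E
    + (2 * (3 ^+ n * (2 * c1) * Cg))%:E * \int[mu]_x (g x `^ q * phi (g x))%:E)%E.
Proof.
move=> Cg0 phig.
pose N j := lambda0 + j%:R.
have lN j : lambda0 <= N j by rewrite lerDl.
have N0 j : 0 <= N j := le_trans (ltW lambda0_gt0) (lN j).
have min0 j x : 0 <= Num.min (f x) (N j) by rewrite le_min f_ge0 N0.
have mfq : measurable_fun setT (fun x => f x `^ q).
  by apply/measurable_EFinP; exact: measurable_int ifq.
have cvgf x : (f x `^ q * phi (Num.min (f x) (N j)))%:E @[j --> \oo] -->
    (f x `^ q * phi (f x))%:E.
  apply: cvg_near_cst; exists (Num.truncn (f x)).+1 => //= j jx.
  rewrite (_ : Num.min (f x) (N j) = f x)//; apply/min_idPl.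
  have fj : f x <= j%:R.
    by apply: (le_trans (ltW (truncnS_gt (f x)))); rewrite ler_nat.
  by rewrite /N; apply: le_trans fj _; rewrite lerDr ltW.
pose F j x := (f x `^ q * phi (Num.min (f x) (N j)))%:E.
have mF j : measurable_fun setT (F j).
  apply/measurable_EFinP; apply: measurable_funM => //.
  by apply: measurable_phi_comp => //; exact: measurable_minr.
have F0 j x : setT x -> (0 <= F j x)%E.
  by rewrite lee_fin mulr_ge0 ?powR_ge0// ltW// phi_gt0.
have ndF x : setT x -> nondecreasing_seq (F ^~ x).
  move=> _ i j ij; rewrite lee_fin ler_wpM2l ?powR_ge0//.
  apply: phi_incr => //; rewrite le_min ge_min lexx/= ge_min.
  by rewrite (_ : N i <= N j) ?orbT// lerD2l ler_nat.
have cvgI := @cvg_monotone_convergence _ _ _ mu _ measurableT F mF F0 ndF.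
rewrite (eq_integral (fun x => limn (F ^~ x))); last first.
  by move=> x _; apply/esym/cvg_lim => //; exact: cvgf.
rewrite -(cvg_lim _ cvgI)//; apply: lime_le; first by apply/cvg_ex; eexists; exact: cvgI.
apply: nearW => j; apply: truncated_bound => // v v0.
exact: phig.
Qed.

End absorption.

(** * The case [4 c0 < 1] *)

Section small_constant.
Context (R : realType) (n : nat) (r0 q c0 c1 l : R) (omega : R -> R) (f g : Rn R n -> R).
Hypotheses (n_gt0 : (0 < n)%N) (r0_gt0 : 0 < r0) (q_gt1 : 1 < q).
Hypothesis omega_cont : {within `[0, +oo[, continuous omega}.
Hypothesis omega_ge0 : forall r, 0 <= r -> 0 <= omega r.
Hypothesis omega_0 : omega 0 = 0.
Hypotheses (c0_gt0 : 0 < c0) (c0_lt : 4 * c0 < 1) (c1_gt0 : 0 < c1) (l_ge1 : 1 <= l).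

Local Notation mu := (lebesgue_Rn R n).

Hypotheses (mf : measurable_fun setT f) (mg : measurable_fun setT g).
Hypotheses (f_ge0 : forall x, 0 <= f x) (g_ge0 : forall x, 0 <= g x).
Hypotheses (ifq : mu.-integrable setT (fun x => (f x `^ q)%:E))
  (igq : mu.-integrable setT (fun x => (g x `^ q)%:E)).
Hypothesis reverse_hoelder : forall (r : R) (x0 : Rn R n), 0 < r <= r0 ->
  mean (cube r x0) (fun x => f x `^ q)
  <= c0 * mean (cube (l * r) x0) f `^ (q + omega r)
     + c1 * mean (cube (l * r) x0) (fun x => g x `^ q).

Lemma lebesgue_point_mean (h : Rn R n -> R) x (e : R) :
  (forall y, 0 <= h y) -> mu.-integrable setT (EFin \o h) ->
  lebesgue_point h x -> 0 < e ->
  exists2 d, 0 < d & forall r, 0 < r < d ->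
    h x - e <= mean (cube r x) h <= h x + e.
Proof.
move=> h0 ih lx e0; have [d d0 hd] := lx _ e0.
have mh : measurable_fun setT h by apply/measurable_EFinP; exact: measurable_int ih.
exists d => // r rd; have /andP[r_gt0 _] := rd.
have mQ := measurable_cube r x.
have rn : 0 < r ^+ n by exact: exprn_gt0.
have mhx : measurable_fun setT (fun y => (`|h y - h x|)%:E).
  exact: measurable_EFin_dist.
have mhE : measurable_fun setT (fun y => (h y)%:E) by exact/measurable_EFinP.
have hE := mean_cube r_gt0 (integrable_cubeS r x ih).
apply/andP; split; rewrite -(ler_pM2r rn) -lee_fin -hE.
- rewrite mulrBl EFinB leeBlDr//; apply: le_trans (leeD2l _ (hd _ rd)).
  rewrite -(integral_cube_cst x (h x) (ltW r_gt0)) -ge0_integralD//; last 3 first.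
  + by move=> y _; rewrite lee_fin.
  + exact: measurable_funTS.
  + exact: measurable_funTS.
  apply: ge0_le_integral => //.
  + by move=> y _; rewrite lee_fin.
  + by apply: measurable_funTS; exact: emeasurable_funD.
  + by move=> y _; rewrite -EFinD lee_fin; have := ler_norm (h x - h y); rewrite distrC; lra.
- rewrite mulrDl EFinD; apply: le_trans (leeD2l _ (hd _ rd)).
  rewrite -(integral_cube_cst x (h x) (ltW r_gt0)) -ge0_integralD//; last 2 first.
  + by move=> y _; rewrite lee_fin.
  + exact: measurable_funTS.
  apply: ge0_le_integral => //.
  + by move=> y _; rewrite lee_fin.
  + exact: measurable_funTS.
  + by apply: measurable_funTS; exact: emeasurable_funD.
  + by move=> y _; rewrite -EFinD lee_fin; have := ler_norm (h y - h x); lra.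
Qed.

Lemma powR_omega_near1 (lambda : R) : 0 < lambda ->
  exists2 d, 0 < d & forall r, 0 < r < d -> lambda `^ omega r <= 5 / 4.
Proof.
move=> l0; have [_ c0w] := (continuous_within_itvcyP _ _).1 omega_cont.
have : expR (omega r * ln lambda) @[r --> 0^'+] --> expR (omega 0 * ln lambda).
  apply: continuous_cvg; first exact: continuous_expR.
  by apply: cvgM => //; exact: cvg_cst.
rewrite omega_0 mul0r expR0 => /cvgrPdist_lt/(_ 4^-1) [|d /= d0 dP].
  by rewrite invr_gt0.
exists d => // r /andP[r_gt0 rd].
have := dP r; rewrite /ball/= sub0r normrN gtr0_norm// => /(_ rd r_gt0).
rewrite /powR gt_eqF// ltr_distlC => /andP[_].
by move=> /ltW /le_trans; apply; lra.
Qed.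

(** As [r] tends to 0 the hypothesis reads roughly [f^q <= c0 f^q + c1 g^q]. With [F = f x ^ q] and
    [G = g x ^ q], the tolerances below give [3F/4 <= (1/4)(2F)(5/4) + c1 G + F/16], which leaves
    [F/16 <= c1 G]. *)
Lemma pointwise_bound x :
  lebesgue_point (fun x => f x `^ q) x -> lebesgue_point (fun x => g x `^ q) x ->
  f x `^ q <= 16 * c1 * g x `^ q.
Proof.
move=> lf lg.
have q0 : 0 < q := lt_trans ltr01 q_gt1.
have lg0 : 0 < l := lt_le_trans ltr01 l_ge1.
have [F0|] := leP (f x `^ q) 0.
  by apply: (le_trans F0); rewrite mulr_ge0 ?powR_ge0// mulr_ge0// ltW.
set F := f x `^ q => F0; set G := g x `^ q.
have G0 : 0 <= G by exact: powR_ge0.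
have fq0 y : 0 <= f y `^ q by exact: powR_ge0.
have gq0 y : 0 <= g y `^ q by exact: powR_ge0.
have F4 : 0 < F / 4 by rewrite divr_gt0.
have e3 : 0 < F / (16 * c1) by rewrite divr_gt0// mulr_gt0.
have [d1 d10 H1] := lebesgue_point_mean fq0 ifq lf F4.
(* The tolerance [F] bounds the mean of [f^q] over the enlarged cube by [2F], hence the mean of [f]
   by [lambda = (2F)^(1/q)]. *)
have [d2 d20 H2] := lebesgue_point_mean fq0 ifq lf F0.
have [d3 d30 H3] := lebesgue_point_mean gq0 igq lg e3.
pose lambda := (2 * F) `^ q^-1.
have F2 : 0 < 2 * F by rewrite mulr_gt0.
have la0 : 0 < lambda by rewrite powR_gt0.
have laq : lambda `^ q = 2 * F.
  by rewrite -powRrM mulVf ?powRr1 ?(ltW F2)// gt_eqF.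
have [d4 d40 H4] := powR_omega_near1 la0.
pose d := Num.min (Num.min d1 d4) (Num.min (Num.min d2 d3) r0).
have d0 : 0 < d by rewrite !lt_min d10 d40 d20 d30.
(* Then [r] and [l r = d / 2] are both below [d]; [l] affects only the size of [r], not the
   bound. *)
pose r := d / (2 * l).
have l2 : 0 < 2 * l by rewrite mulr_gt0.
have r_gt0 : 0 < r by rewrite divr_gt0.
have lrE : l * r = d / 2 by rewrite /r; field; rewrite gt_eqF.
have lr_gt0 : 0 < l * r by rewrite mulr_gt0.
have lrd : l * r < d by rewrite lrE; lra.
have rlr : r <= l * r by rewrite ler_peMl// ltW.
have rd : r < d := le_lt_trans rlr lrd.
move: (lrd) (rd); rewrite {1 2}/d !lt_min => /andP[_ /andP[/andP[lr2 lr3] _]].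
move=> /andP[/andP[r1 r4] /andP[_ rr0]].
have /andP[m1 _] : F - F / 4 <= mean (cube r x) (fun y => f y `^ q) <= F + F / 4.
  by apply: H1; rewrite r_gt0.
have /andP[_ m2] : F - F <= mean (cube (l * r) x) (fun y => f y `^ q) <= F + F.
  by apply: H2; rewrite lr_gt0.
have /andP[_ m3] : G - F / (16 * c1) <= mean (cube (l * r) x) (fun y => g y `^ q)
    <= G + F / (16 * c1).
  by apply: H3; rewrite lr_gt0.
have w4 : lambda `^ omega r <= 5 / 4 by apply: H4; rewrite r_gt0.
have m_le : mean (cube (l * r) x) f <= lambda.
  apply: (mean_fun_le q_gt1 mf f_ge0 ifq la0 lr_gt0).
  rewrite (mean_cube lr_gt0 (integrable_cubeS _ _ ifq)) lee_fin.
  by rewrite ler_wpM2r ?exprn_ge0 ?(ltW lr_gt0)// laq mulr_natl mulr2n.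
have m_ge0 : 0 <= mean (cube (l * r) x) f.
  apply: mulr_ge0; first by rewrite invr_ge0; exact: fine_ge0.
  by apply: Rintegral_ge0 => y _.
have mpow : mean (cube (l * r) x) f `^ (q + omega r) <= 2 * F * (5 / 4).
  have o0 := omega_ge0 (ltW r_gt0).
  apply: (@le_trans _ _ (lambda `^ (q + omega r))).
    by apply: ge0_ler_powR; rewrite ?nnegrE ?(ltW la0)// addr_ge0// ltW.
  rewrite powRD; last by apply/implyP => _; rewrite gt_eqF.
  by rewrite laq ler_wpM2l// ltW.
have rr : 0 < r <= r0 by rewrite r_gt0 ltW.
have := reverse_hoelder x rr.
have c1F : c1 * (F / (16 * c1)) = F / 16 by field; rewrite gt_eqF.
have s1 := ler_wpM2l (ltW c0_gt0) mpow.
have s2 := ler_wpM2l (ltW c1_gt0) m3; rewrite mulrDr c1F in s2.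
have s3 : c0 * (2 * F * (5 / 4)) <= 4^-1 * (2 * F * (5 / 4)).
  rewrite ler_wpM2r ?mulr_ge0 ?(ltW F0)// -[leRHS]mul1r ler_pdivlMr//.
  by rewrite mulrC ltW.
move=> rh; have : F / 16 <= c1 * G by lra.
by rewrite ler_pdivrMr// => /le_trans; apply; rewrite -mulrA mulrC.
Qed.

(** Almost everywhere [f <= (16 c1)^(1/q) g], and the doubling of [phi] carries this through [phi];
    the maximum with 1 makes the factor admissible in [phi_doubling]. *)
Lemma small_constant_estimate (phi : R -> R) (Cphi : R) :
  (forall s, 0 <= s -> 0 < phi s) ->
  (forall s t, 0 <= s -> s <= t -> phi s <= phi t) ->
  0 < Cphi ->
  (forall s, 0 <= s -> phi (Num.max 1 ((16 * c1) `^ q^-1) * s) <= Cphi * phi s) ->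
  (\int[mu]_x (f x `^ q * phi (f x))%:E <=
    (16 * c1 * Cphi)%:E * \int[mu]_x (g x `^ q * phi (g x))%:E)%E.
Proof.
move=> phi_gt0 phi_incr Cphi0 phiD.
have q0 : 0 < q := lt_trans ltr01 q_gt1.
have c16 : 0 < 16 * c1 by rewrite mulr_gt0.
have phi0 (h : Rn R n -> R) x : (forall y, 0 <= h y) -> 0 <= h x `^ q * phi (h x).
  by move=> h0; rewrite mulr_ge0 ?powR_ge0// ltW// phi_gt0.
have mphi (h : Rn R n -> R) : measurable_fun setT h -> (forall y, 0 <= h y) ->
    measurable_fun setT (fun x => (h x `^ q * phi (h x))%:E).
  move=> mh h0; apply/measurable_EFinP; apply: measurable_funM.
    exact: (measurableT_comp (measurable_powR _)).
  exact: measurable_phi_comp.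
rewrite -ge0_integralZl//; last 3 first.
- exact: mphi.
- by move=> x _; rewrite lee_fin phi0.
- by rewrite lee_fin mulr_ge0// ltW.
apply: ae_ge0_le_integral => //.
- by move=> x _; rewrite lee_fin phi0.
- exact: mphi.
- by move=> x _; rewrite mule_ge0// lee_fin ?phi0// mulr_ge0// ltW.
- by apply: measurable_funeM; exact: mphi.
apply: negligibleS (negligibleU (lebesgue_differentiation_Rn ifq)
  (lebesgue_differentiation_Rn igq)) => x /=.
apply: contra_notP => /not_orP[/contrapT lf /contrapT lg] _.
have fg := pointwise_bound lf lg.
have fDg : f x <= Num.max 1 ((16 * c1) `^ q^-1) * g x.
  apply: (@le_trans _ _ ((16 * c1) `^ q^-1 * g x)); last first.
    by rewrite ler_wpM2r// le_max lexx orbT.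
  have -> : f x = (f x `^ q) `^ q^-1 by rewrite -powRrM divff ?powRr1 ?gt_eqF.
  have -> : g x = (g x `^ q) `^ q^-1 by rewrite -powRrM divff ?powRr1 ?gt_eqF.
  rewrite -powRM ?powR_ge0 ?(ltW c16)//; apply: ge0_ler_powR => //.
  - by rewrite invr_ge0 ltW.
  - by rewrite nnegrE powR_ge0.
  - by rewrite nnegrE mulr_ge0 ?powR_ge0// ltW.
rewrite -EFinM lee_fin (_ : 16 * c1 * Cphi * _ =
  16 * c1 * g x `^ q * (Cphi * phi (g x))); last by ring.
apply: ler_pM => //; first exact: powR_ge0.
  by rewrite ltW// phi_gt0.
by apply: le_trans (phiD _ (g_ge0 x)); exact: phi_incr.
Qed.

End small_constant.

(** * The two cases of [4 c0], each with a constant chosen before [l], [f] and [g] *)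

Theorem theorem2p1 (R : realType) (n : nat) (r0 q c0 c1 theta : R)
    (omega phi : R -> R)
    (n_gt0 : (0 < n)%N) (r0_gt0 : 0 < r0) (r0_lt1 : r0 < 1)
    (omega_ge0 : forall r, 0 <= r -> 0 <= omega r)
    (omega_nd : forall x y, 0 <= x -> x <= y -> omega x <= omega y)
    (omega_cont : {within `[0, +oo[, continuous omega})
    (omega_diff : forall r, 0 < r <= r0 ->
      exists2 d, 0 <= d & has_derivative_within `]0, r0] omega r d)
    (omega_0 : omega 0 = 0) (omega0_lt1 : omega0 r0 omega < 1)
    (q_gt1 : 1 < q)
    (sup_fin : forall k, 1 <= k ->
      (supint n q r0 omega k (lambda0 n q r0) < +oo)%E)
    (c0_gt0 : 0 < c0) (c1_gt0 : 0 < c1)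
    (theta_gt0 : 0 < theta)
    (theta_eq :
      ((4 ^+ n * (4 * c0) `^ q * theta)%:E
         * expeR (theta%:E * Mfun n q r0 omega (4 * c0))
         * ((q - 1)^-1)%:E = (2^-1)%:E)%E)
    (phi_gt0 : forall s, 0 <= s -> 0 < phi s)
    (phi_incr : forall s t, 0 <= s -> s <= t -> phi s <= phi t)
    (phi_C1 : C1_on `[0, +oo[ phi)
    (phi_eq : forall s, s0 n q r0 omega / (4 * c0) <= s ->
      phi s = expR (theta * (1 - omega0 r0 omega)
        * oint (s0 n q r0 omega / (4 * c0)) s (weight n q r0 omega))) :
  exists2 C : R, 0 < C &
    forall (l : R) (f g : Rn R n -> R),
      1 <= l ->
      f \in Lfun (lebesgue_Rn R n) q%:E ->
      g \in Lfun (lebesgue_Rn R n) q%:E ->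
      (forall x, 0 <= f x) -> (forall x, 0 <= g x) ->
      ('N[lebesgue_Rn R n]_(q%:E) [EFin \o f] <= 1)%E ->
      (forall (r : R) (x0 : Rn R n), 0 < r <= r0 ->
        mean (cube r x0) (fun x => f x `^ q)
        <= c0 * mean (cube (l * r) x0) f `^ (q + omega r)
           + c1 * mean (cube (l * r) x0) (fun x => g x `^ q)) ->
      (\int[lebesgue_Rn R n]_x (f x `^ q * phi (f x))%:E
       <= (4 * phi (lambda0 n q r0))%:E
          + C%:E * \int[lebesgue_Rn R n]_x (g x `^ q * phi (g x))%:E)%E.
Proof.
have q0 : 0 < q := lt_trans ltr01 q_gt1.
have q1' : 0 < q - 1 by rewrite subr_gt0.
have k_gt0 : 0 < 4 * c0 by rewrite mulr_gt0.
pose A := 4 ^+ n * (4 * c0) `^ q * theta.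
have A_gt0 : 0 < A by rewrite mulr_gt0// mulr_gt0 ?powR_gt0// exprn_gt0.
have M_nNy : Mfun n q r0 omega (4 * c0) != -oo%E.
  rewrite -ltNye; apply: (@lt_le_trans _ _
    (oint (s0 n q r0 omega / (4 * c0)) (lambdafun n q r0 omega
      (4 * c0 * (s0 n q r0 omega / (4 * c0)))) (weight n q r0 omega))%:E).
    exact: ltNyr.
  apply: ereal_sup_ubound; exists (s0 n q r0 omega / (4 * c0)) => //=.
  by rewrite in_itv/= lexx.
(* [M(4 c0) = +oo] would make the left-hand side of [theta_eq] infinite. *)
have Mfin : Mfun n q r0 omega (4 * c0) \is a fin_num.
  move: theta_eq M_nNy; case: (Mfun _ _ _ _ _) => // + _.
  rewrite gt0_muley ?lte_fin//= gt0_muley ?lte_fin//.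
  by rewrite gt0_mulye// lte_fin invr_gt0.
have theta_eqR : 4 ^+ n * (4 * c0) `^ q * theta *
    expR (theta * fine (Mfun n q r0 omega (4 * c0))) / (q - 1) = 2^-1.
  by move: theta_eq; rewrite -{1}(fineK Mfin) -!EFinM => -[].
have unpack (h : Rn R n -> R) : h \in Lfun (lebesgue_Rn R n) q%:E ->
    (forall x, 0 <= h x) -> measurable_fun setT h /\
    (lebesgue_Rn R n).-integrable setT (fun x => (h x `^ q)%:E).
  move=> hL h0; split.
    by move: (hL); rewrite inE => /andP[/[!inE]].
  have := Lfun_integrable (ltW q_gt1) hL.
  rewrite (_ : (fun x => _) = fun x => (h x `^ q)%:E)//.
  by apply/funext => x; rewrite ger0_norm.
have [k_ge1|k_lt1] := leP 1 (4 * c0).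
- have [Cg Cg0 phig] := @layer_upper _ _ _ _ _ _ _ _ n_gt0 q_gt1 r0_gt0 r0_lt1 omega_ge0
    omega_cont omega0_lt1 k_gt0 theta_gt0 phi_gt0 phi_incr phi_eq k_ge1
    ((4 * c1) `^ q^-1) (powR_gt0 _ (mulr_gt0 (ltr0n R 4) c1_gt0)).
  exists (2 * (3 ^+ n * (2 * c1) * Cg)); first by rewrite !mulr_gt0// exprn_gt0.
  move=> l f g l_ge1 fL gL f_ge0 g_ge0 fN rh.
  have [mf ifq] := unpack _ fL f_ge0; have [mg igq] := unpack _ gL g_ge0.
  apply: (absorbed_estimate n_gt0 r0_gt0 r0_lt1 omega_ge0 omega_nd omega_cont
    omega0_lt1 q_gt1 k_ge1 c1_gt0 theta_gt0 Mfin theta_eqR phi_gt0 phi_incr phi_eq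
    l_ge1 mf mg f_ge0 g_ge0 ifq igq _ rh Cg0 phig).
  have N0 : (0 <= 'N[lebesgue_Rn R n]_(q%:E) [EFin \o f])%E by exact: Lnorm_ge0.
  have : ('N[lebesgue_Rn R n]_(q%:E) [EFin \o f] `^ q <= 1 `^ q)%E.
    apply: gt0_ler_poweR => //; first exact: ltW.
    + by rewrite in_itv/= N0 leey.
    + by rewrite in_itv/= leey andbT.
  rewrite poweR1r poweR_Lnorm ?gt_eqF//.
  rewrite (eq_integral (fun x => (f x `^ q)%:E))// => x _.
  by rewrite /= ger0_norm.
- have [|Cphi Cphi0 phiD] := @phi_doubling _ _ _ _ _ _ _ _ n_gt0 q_gt1 r0_gt0 r0_lt1
    omega_ge0 omega_cont omega0_lt1 k_gt0 theta_gt0 phi_gt0 phi_incr phi_eq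
    (Num.max 1 ((16 * c1) `^ q^-1)).
    by rewrite le_max lexx.
  exists (16 * c1 * Cphi); first by rewrite !mulr_gt0.
  move=> l f g l_ge1 fL gL f_ge0 g_ge0 _ rh.
  have [mf ifq] := unpack _ fL f_ge0; have [mg igq] := unpack _ gL g_ge0.
  apply: le_trans (small_constant_estimate r0_gt0 q_gt1 omega_cont omega_ge0 omega_0
    c0_gt0 k_lt1 c1_gt0 l_ge1 mf mg f_ge0 g_ge0 ifq igq rh phi_gt0 phi_incr Cphi0 phiD) _.
  rewrite leeDr// lee_fin mulr_ge0// ltW// phi_gt0//.
  exact: (ltW (lt_trans ltr01 (lambda0_gt1 n_gt0 q_gt1 r0_gt0 r0_lt1))).
Qed.
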